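(* Consider the linear latent non-Gaussian model and its two-block Gibbs sampler (under either the centered or the non-centered parameterization), with $V$-marginal transition density $k$ and Markov operator $\Lambda$ on $L_2(\pi)$, all as described in the context. Then $\Lambda$ is trace-class on $L_2(\pi)$ if either of the following conditions holds: (1) $a>0$, $b>0$ and $p\in\mathbb{R}$; (2) $a>0$, $b=0$ and $p>\tfrac12$.
   Context: GIG distribution: $\mathrm{GIG}(p,a,b)$ is the law on $(0,\infty)$ with density proportional to $x^{p-1}\exp\{-\tfrac12(ax+b/x)\}$, for parameters with ($a>0,b>0,p\in\mathbb{R}$) or ($a=0,b>0,p<0$) or ($a>0,b=0,p>0$). Model (LLnGM): fix $m,n\ge 1$, a matrix $A\in\mathbb{R}^{m\times n}$, an invertible matrix $K\in\mathbb{R}^{n\times n}$, a design matrix $X$ with coefficient vector $\beta$, a vector $h\in\mathbb{R}^n$, $\mu\in\mathbb{R}$, $\sigma>0$, $\sigma_\epsilon>0$ and GIG parameters $(p,a,b)$. Centered parameterization, latent field $W\in\mathbb{R}^n$: $Y\mid W,V\sim N(X\beta+AW,\sigma_\epsilon^2 I)$, $KW\mid V\sim N(\mu V-\mu h,\mathrm{diag}(\sigma^2V))$, $V_1,\dots,V_n$ independent $\mathrm{GIG}(p,a,b)$. Non-centered parameterization, latent field $M=KW+\mu h$: $Y\mid M,V\sim N(X\beta+AK^{-1}(M-\mu h),\sigma_\epsilon^2 I)$, $M\mid V\sim N(\mu V,\mathrm{diag}(\sigma^2V))$, same $V$. The data $Y\in\mathbb{R}^m$ are fixed. Let $U=W$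 (centered) or $U=M$ (non-centered). The Gibbs sampler alternately draws $U^{(t)}\sim\pi(\cdot\mid V^{(t-1)},Y)$ and $V^{(t)}\sim\pi(\cdot\mid U^{(t)},Y)$. The chain $(V^{(t)})$ on $(0,\infty)^n$ has transition density $k(V,\tilde V)=\int_{\mathbb{R}^n}\pi(\tilde V\mid U,Y)\pi(U\mid V,Y)\,dU$ (conditional densities being defined for almost every $U$). $\pi$ denotes the probability measure with posterior density $\pi(V\mid Y)$; $L_2(\pi)$ is the real Hilbert space of $\pi$-square-integrable functions on $(0,\infty)^n$, and $(\Lambda f)(V)=\int_{(0,\infty)^n}k(V,\tilde V)f(\tilde V)\,d\tilde V$ on $L_2(\pi)$. *)

(* Defs.v *)
From HB Require Import structures.
From mathcomp Require Import all_boot all_order all_algebra.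
From mathcomp Require Import all_classical all_reals all_analysis.

Set Implicit Arguments.
Unset Strict Implicit.
Unset Printing Implicit Defensive.
Import Order.TTheory GRing.Theory Num.Theory.
Import numFieldNormedType.Exports.

Local Open Scope classical_set_scope.
Local Open Scope ring_scope.

(* Points of R^n are tuples, which carry the product sigma-algebra; [vec] turns
   them into column vectors for linear algebra. *)
Notation Rn R n := (n.-tuple (measurableTypeR R)).

Definition vec (R : realType) n (x : Rn R n) : 'cV[R]_n := \col_i tnth x i.

Section lebesgue_Rn.
Context {R : realType}.

Definition cons_Rn n (z : Rn R n * measurableTypeR R) : Rn R n.+1 :=
  [tuple of z.2 :: z.1].

Lemma measurable_cons_Rn n : measurable_fun setT (@cons_Rn n).
Proof. exact: measurable_cons. Qed.

Fixpoint lebesgue_Rn n : {measure set (Rn R n) -> \bar R} :=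
  match n with
  | 0 => dirac [tuple]
  | k.+1 => @measure_function_pushforward__canonical__measure_function_Measure
      _ _ _ _ _ (lebesgue_Rn k \x lebesgue_measure)%E _ (@measurable_cons_Rn k)
  end.

End lebesgue_Rn.

(* Unnormalized GIG density; only its values at x > 0 matter. *)
Definition gig_kernel (R : realType) (p a b x : R) : R :=
  x `^ (p - 1) * expR (- (2^-1 * (a * x + b / x))).

Definition gig_pdf (R : realType) (p a b x : R) : R :=
  gig_kernel p a b x /
  \int[@lebesgue_measure R]_(t in `]0, +oo[) gig_kernel p a b t.

Definition gig_params (R : realType) (p a b : R) : Prop :=
  [\/ [/\ 0 < a & 0 < b], [/\ a = 0, 0 < b & p < 0]
    | [/\ 0 < a, b = 0 & 0 < p]].

Definition mvn_pdf (R : realType) n (m : 'cV[R]_n) (S : 'M[R]_n)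
    (x : 'cV[R]_n) : R :=
  (Num.sqrt ((2 * pi) ^+ n * \det S))^-1 *
  expR (- (2^-1 * ((x - m)^T *m invmx S *m (x - m)) ord0 ord0)).

(* [q] is the number of covariates: X is m x q and beta has q entries. *)
Record llngm (R : realType) (m n q : nat) := LLnGM {
  ll_A : 'M[R]_(m, n);
  ll_K : 'M[R]_n;
  ll_X : 'M[R]_(m, q);
  ll_beta : 'cV[R]_q;
  ll_h : 'cV[R]_n;
  ll_mu : R;
  ll_sigma : R;
  ll_sigma_eps : R;
  ll_p : R;
  ll_a : R;
  ll_b : R
}.

Variant parameterization := Centered | NonCentered.

Section gibbs.
Context (R : realType) (m n q : nat) (par : parameterization).
Context (M : llngm R m n q) (y : 'cV[R]_m).

Local Notation Rn := (Rn R n).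
Local Notation leb := (@lebesgue_Rn R n).

Definition orthant : set Rn := [set v | forall i, 0 < (tnth v i : R)].

Definition likelihood (u : Rn) : R :=
  let W := match par with
    | Centered => vec u
    | NonCentered => invmx (ll_K M) *m (vec u - ll_mu M *: ll_h M)
    end in
  mvn_pdf (ll_X M *m ll_beta M + ll_A M *m W) ((ll_sigma_eps M ^+ 2)%:M) y.

Definition scale_mx (v : Rn) : 'M[R]_n :=
  diag_mx (\row_i (ll_sigma M ^+ 2 * tnth v i)).

(* Density of U given V = v.  In the centered case the normal density is that
   of K W, whence the Jacobian factor |det K| for the density of W. *)
Definition latent_pdf (v u : Rn) : R :=
  match par with
  | Centered => `|\det (ll_K M)| *
      mvn_pdf (ll_mu M *: vec v - ll_mu M *: ll_h M) (scale_mx v) (ll_K M *m vec u)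
  | NonCentered => mvn_pdf (ll_mu M *: vec v) (scale_mx v) (vec u)
  end.

Definition mixing_pdf (v : Rn) : R :=
  \prod_(i < n) gig_pdf (ll_p M) (ll_a M) (ll_b M) (tnth v i).

(* Unlike [pdf_V] below, this is not normalized: Y is frozen at the data y. *)
Definition joint_pdf (u v : Rn) : R :=
  likelihood u * latent_pdf v u * mixing_pdf v.

Definition pdf_V (v : Rn) : R :=
  (\int[leb]_u joint_pdf u v) /
  (\int[leb]_(w in orthant) \int[leb]_u joint_pdf u w).

Definition pdf_V_given_U (u v : Rn) : R :=
  joint_pdf u v / \int[leb]_(w in orthant) joint_pdf u w.

Definition pdf_U_given_V (v u : Rn) : R :=
  joint_pdf u v / \int[leb]_w joint_pdf w v.

Definition gibbs_kernel (v v' : Rn) : \bar R :=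
  (\int[leb]_u (pdf_V_given_U u v' * pdf_U_given_V v u)%:E)%E.

(* The law on (0, oo)^n with density [pdf_V], seen as a measure on R^n. *)
Definition is_posterior (P : {measure set Rn -> \bar R}) : Prop :=
  forall E, measurable E ->
    P E = (\int[leb]_(v in E `&` orthant) (pdf_V v)%:E)%E.

(* [L] is the operator f |-> \int k(., v') f(v') dv' on L^2(P). *)
Definition is_gibbs_operator (P : {measure set Rn -> \bar R})
    (L : LspaceType2 P -> LspaceType2 P) : Prop :=
  forall f : LspaceType2 P, {ae P, forall v,
    leb.-integrable orthant (fun v' => gibbs_kernel v v' * (f v' : R)%:E)%E /\
    (L f v : R)%:E = (\int[leb]_(v' in orthant)
                        (gibbs_kernel v v' * (f v' : R)%:E))%E}.

End gibbs.

Section L2_operators.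
Context d (T : measurableType d) (R : realType) (P : {measure set T -> \bar R}).
Local Notation L2 := (LspaceType2 P).

Definition inner (f g : L2) : R := \int[P]_x ((f x : R) * (g x : R)).

Definition norm2 (f : L2) : R := Num.sqrt (inner f f).

(* The library does not equip [L2] with vector space operations, so linear
   combinations are written pointwise, up to null sets. *)
Definition bounded_linear_operator (L : L2 -> L2) : Prop :=
  (forall (c : R) (f g r : L2),
     r = (fun x => c * (f x : R) + (g x : R)) %[ae P] ->
     L r = (fun x => c * (L f x : R) + (L g x : R)) %[ae P]) /\
  (exists C : R, forall f, norm2 (L f) <= C * norm2 f).

Definition adjoint_operator (L L' : L2 -> L2) : Prop :=
  forall f g, inner (L f) g = inner f (L' g).

Definition positive_operator (L : L2 -> L2) : Prop :=
  adjoint_operator L L /\ forall f, 0 <= inner (L f) f.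

(* S = |L|, i.e. the positive square root of L* L *)
Definition absolute_value (L S : L2 -> L2) : Prop :=
  [/\ bounded_linear_operator S, positive_operator S &
      exists2 L', adjoint_operator L L' & forall f, S (S f) = L' (L f)].

Definition orthonormal_basis (I : choiceType) (e : I -> L2) : Prop :=
  (forall i j, inner (e i) (e j) = (i == j)%:R) /\
  (forall f : L2, (forall i, inner f (e i) = 0) -> f = cst 0 %[ae P]).

(* L is bounded and |L| has finite trace.  As |L| is positive, the trace does
   not depend on the orthonormal basis. *)
Definition trace_class (L : L2 -> L2) : Prop :=
  bounded_linear_operator L /\
  exists2 S, absolute_value L S &
    exists (I : choiceType) (e : I -> L2), orthonormal_basis e /\
      (\esum_(i in [set: I]) (inner (S (e i)) (e i))%:E < +oo)%E.

End L2_operators.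

(* Main.v *)
(* With j(u, v) the joint density of the latent field and V at the data, G and J
   its two marginals and Z its mass, put q(u, v) = Z^(1/2) j(u, v) / (G(u)^(1/2) J(v)).
   Against the posterior density J / Z the Gibbs kernel is the integral of
   q(u, v) q(u, v') over u, so that Lambda = Q* Q for the integral operator Q with
   kernel q.  Hence |Lambda| = Lambda, and by Bessel's inequality its trace is at
   most the squared Hilbert-Schmidt norm of Q, that is, the integral of j^2 / (G J).

   To see that this integral is finite, note that under both parameterizations j is
   a Gaussian weight of u times a product over i of g(m_i(u), v_i), where m_i is
   affine in u and g(x, t) = t^r exp(-((x - mu t)^2 / (sigma^2 t) + b / t + a t) / 2)
   with r = p - 3/2.  The integral gamma(x) of g(x, t) over t > 0 decays no faster
   than exp(mu x / sigma^2 - k |x| / sigma) for any k > (a + mu^2 / sigma^2)^(1/2),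
   and completing squares yields 0 < l < 1 and d > 0 such that
   g(x, t)^2 / gamma(x) <= C g(l x, t) w(t) with w(t) = t^r exp(-b / (2 t) - d t).
   Contracting u by the factor l towards the common zero of the m_i and changing
   variables, the integral over u of j^2 / G is at most C' J(v) times the product of
   the w(v_i).  This leaves a power of the integral of w, which is finite if b > 0
   or r > -1. *)
Require Import Defs.
From HB Require Import structures.
From mathcomp Require Import all_boot all_order all_algebra.
From mathcomp Require Import all_classical all_reals all_analysis.
From mathcomp Require Import measurable_realfun ring lra.
Import Order.TTheory GRing.Theory Num.Theory.
Import numFieldNormedType.Exports.

Set Implicit Arguments.
Unset Strict Implicit.
Unset Printing Implicit Defensive.

Local Open Scope classical_set_scope.
Local Open Scope ring_scope.

(** * Square-integrable functions and Hilbert-Schmidt kernels *)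

Section square_integrable.
Context d (T : measurableType d) (R : realType).
Variable mu : {measure set T -> \bar R}.
Implicit Types f g h : T -> R.

(** Square integrability is stated for plain functions, which can be added and multiplied pointwise.
    [L2_sqint] and [sqint_L2] translate to and from the elements of [LspaceType2]. *)
Definition sqint f :=
  measurable_fun setT f /\ (\int[mu]_x (f x ^+ 2)%:E < +oo)%E.

Definition ip f g : R := \int[mu]_x (f x * g x).

Lemma measurable_sq f : measurable_fun setT f ->
  measurable_fun setT (fun x => (f x ^+ 2)%:E ).
Proof. by move=> mf; apply/measurable_EFinP; exact: measurable_funX. Qed.

Lemma sqint_integrable_sq f : sqint f ->
  mu.-integrable setT (fun x => (f x ^+ 2)%:E).
Proof.
move=> [mf f2]; apply/integrableP; split; first exact: measurable_sq.
by under eq_integral do rewrite /= ger0_norm ?sqr_ge0//.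
Qed.

(** Domination by |f g| <= f^2 + g^2. *)
Lemma sqint_integrable f g : sqint f -> sqint g ->
  mu.-integrable setT (fun x => (f x * g x)%:E).
Proof.
move=> sf sg; apply: (@le_integrable _ _ _ _ _ measurableT _
    (fun x => (f x ^+ 2)%:E + (g x ^+ 2)%:E)%E).
- by apply/measurable_EFinP/measurable_funM; [apply sf.1|apply sg.1].
- move=> x _ /=; rewrite lee_fin [leRHS]ger0_norm ?addr_ge0 ?sqr_ge0//.
  rewrite ler_norml; have := sqr_ge0 (f x + g x); have := sqr_ge0 (f x - g x).
  by have := sqr_ge0 (f x); have := sqr_ge0 (g x); nra.
- by apply: integrableD => //; exact: sqint_integrable_sq.
Qed.

Lemma sqint_lin (c : R) f g : sqint f -> sqint g ->
  sqint (fun x => c * f x + g x).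
Proof.
move=> sf sg; have mfg : measurable_fun setT (fun x => c * f x + g x).
  by apply: measurable_funD (sg.1); apply: measurable_funM (sf.1).
split=> //; apply: integrable_lty => //.
apply: (@le_integrable _ _ _ _ _ measurableT _
    (fun x => (2 * c ^+ 2)%:E * (f x ^+ 2)%:E + 2%:E * (g x ^+ 2)%:E)%E).
- exact: measurable_sq.
- move=> x _ /=; rewrite lee_fin ger0_norm ?sqr_ge0// ger0_norm; last first.
    have := sqr_ge0 (c * f x); have := sqr_ge0 (g x); rewrite exprMn; lra.
  by have := sqr_ge0 (c * f x - g x); nra.
- apply: integrableD => //; apply: integrableZl => //;
  exact: sqint_integrable_sq.
Qed.

Lemma sqint0 : sqint (cst 0).
Proof.
split=> //; under eq_integral do rewrite /= expr0n/=.
by rewrite integral0.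
Qed.

Lemma sqint_ae f g : measurable_fun setT g -> f = g %[ae mu] -> sqint f ->
  sqint g.
Proof.
move=> mg fg [mf f2]; split=> //.
rewrite -(@ge0_ae_eq_integral _ _ _ _ setT (fun x => (f x ^+ 2)%:E))//.
- exact: measurable_sq.
- exact: measurable_sq.
- by move=> x _; rewrite lee_fin sqr_ge0.
- by move=> x _; rewrite lee_fin sqr_ge0.
- by apply: filterS fg => x /= /[apply] ->.
Qed.

Lemma ipC f g : ip f g = ip g f.
Proof. by apply: eq_Rintegral => x _; rewrite mulrC. Qed.

Lemma ip_lin (c : R) f g h : sqint f -> sqint g -> sqint h ->
  ip (fun x => c * f x + g x) h = c * ip f h + ip g h.
Proof.
move=> sf sg sh; rewrite /ip -RintegralZl//; last exact: sqint_integrable.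
rewrite -RintegralD//; last 2 first.
  rewrite [_ \o _](_ : _ = (fun x => c%:E * (f x * h x)%:E)%E)//.
  by apply: integrableZl => //; exact: sqint_integrable.
  exact: sqint_integrable.
by apply: eq_Rintegral => x _; rewrite mulrDl mulrA.
Qed.

Lemma ip_ge0 f : 0 <= ip f f.
Proof. by apply: Rintegral_ge0 => x _; rewrite -expr2 sqr_ge0. Qed.

Lemma ip_ae f f' g g' : measurable_fun setT f -> measurable_fun setT g ->
  measurable_fun setT f' -> measurable_fun setT g' ->
  f = f' %[ae mu] -> g = g' %[ae mu] -> ip f g = ip f' g'.
Proof.
move=> mf mg mf' mg' ff' gg'; congr fine; apply: ae_eq_integral => //.
- by apply/measurable_EFinP/measurable_funM.
- by apply/measurable_EFinP/measurable_funM.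
- by apply: filterS2 ff' gg' => x /= ff gg /[dup] /ff -> /gg ->.
Qed.

Lemma ipxx f : sqint f -> (ip f f)%:E = (\int[mu]_x (f x ^+ 2)%:E)%E.
Proof.
move=> sf; rewrite /ip /Rintegral fineK; last first.
  by apply: integrable_fin_num => //; exact: sqint_integrable.
by apply: eq_integral => x _; rewrite expr2.
Qed.

(** The quadratic [ip] of t f + g with itself is nonnegative for every real t. *)
Lemma cauchy_schwarz f g : sqint f -> sqint g ->
  ip f g ^+ 2 <= ip f f * ip g g.
Proof.
move=> sf sg.
have H t : 0 <= t ^+ 2 * ip f f + 2 * t * ip f g + ip g g.
  have := ip_ge0 (fun x => t * f x + g x); rewrite ip_lin//; last exact: sqint_lin.
  rewrite [X in t * X]ipC [X in _ + X]ipC ip_lin// ip_lin// (ipC g f).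
  by move=> h; apply: le_trans h _; nra.
have f0 := ip_ge0 f; have [ff0|ff0] := eqVneq (ip f f) 0.
  have [fg0|fg0] := eqVneq (ip f g) 0; first by rewrite fg0 ff0 expr0n/= mul0r.
  (* When [ip f f] vanishes the quadratic is affine in t, and at this t it equals -1. *)
  have := H (- (ip g g + 1) / (2 * ip f g)); rewrite ff0 mulr0 add0r.
  rewrite [X in X + _](_ : _ = - (ip g g + 1)); last by field.
  by move=> ?; exfalso; lra.
have fp : 0 < ip f f by rewrite lt_neqAle eq_sym ff0.
(* This t minimizes the quadratic. *)
have := H (- ip f g / ip f f).
rewrite (_ : _ + _ = ip g g - ip f g ^+ 2 / ip f f); last by field.
by rewrite subr_ge0 ler_pdivrMr// mulrC.
Qed.

(** The residual r of g after projection on the [e i] is orthogonal to each of them. Hence [ip r r]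
    is [ip g g] minus the sum of squares, and it is nonnegative. *)
Lemma bessel (I : eqType) (s : seq I) (e : I -> T -> R) g : sqint g ->
  (forall i, i \in s -> sqint (e i)) ->
  (forall i j, i \in s -> j \in s -> ip (e i) (e j) = (i == j)%:R) -> uniq s ->
  \sum_(i <- s) ip g (e i) ^+ 2 <= ip g g.
Proof.
move=> sg se on us; pose r := fun x => g x - \sum_(i <- s) ip g (e i) * e i x.
suff [sr rr rO] : [/\ sqint r, ip r r = ip g g - \sum_(i <- s) ip g (e i) ^+ 2 &
    forall h, sqint h ->
    ip r h = ip g h - \sum_(i <- s) ip g (e i) * ip (e i) h].
  by rewrite -subr_ge0 -rr ip_ge0.
(* The terms are subtracted one at a time. The induction runs over sublists of s, on which the [e i]
   remain square integrable. *)
have: forall s', {subset s' <= s} ->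
  let r' := fun x => g x - \sum_(i <- s') ip g (e i) * e i x in
  sqint r' /\ (forall h, sqint h ->
    ip r' h = ip g h - \sum_(i <- s') ip g (e i) * ip (e i) h).
  elim=> [|i s' ih] ss' /=.
    have -> : (fun x => g x - \sum_(i <- [::]) ip g (e i) * e i x) = g.
      by apply/funext => x; rewrite big_nil subr0.
    by split=> // h sh; rewrite big_nil subr0.
  have [|sr rh] := ih; first by move=> j js; apply: ss'; rewrite inE js orbT.
  have si : sqint (e i) by apply: se; apply: ss'; rewrite inE eqxx.
  have -> : (fun x => g x - \sum_(j <- i :: s') ip g (e j) * e j x) =
      (fun x => (- ip g (e i)) * e i x +
        (fun x => g x - \sum_(j <- s') ip g (e j) * e j x) x).
    by apply/funext => x; rewrite big_cons; ring.
  split; first exact: sqint_lin.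
  by move=> h sh; rewrite ip_lin// rh// big_cons; ring.
move=> /(_ s (fun _ => id)); rewrite -/r => -[sr rh]; split=> //.
have re i : i \in s -> ip r (e i) = 0.
  move=> si; rewrite rh//; last exact: se.
  rewrite (bigD1_seq i)//= on// eqxx mulr1 big_seq_cond big1 ?addr0 ?subrr//.
  by move=> j /andP[js ji]; rewrite on// (negbTE ji) mulr0.
rewrite (rh r)// big_seq big1 ?subr0; last first.
  by move=> i si; rewrite (ipC (e i)) re// mulr0.
rewrite ipC (rh g)//; congr (_ - _).
by apply: eq_bigr => i _; rewrite expr2 (ipC (e i)).
Qed.

End square_integrable.

(** * Square-integrable functions as elements of L2 *)

Section L2_space.
Context d (T : measurableType d) (R : realType).
Variable P : {measure set T -> \bar R}.

Lemma L2_measurable (f : LspaceType2 P) : measurable_fun setT (f : T -> R).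
Proof. exact (measurable_funP (repr (LebesgueSpace.sort f))). Qed.

Lemma L2_sqint (f : LspaceType2 P) : sqint P (f : T -> R).
Proof.
split; first exact: L2_measurable.
have := @Lebesgue_finite _ _ _ _ _ _ f; rewrite /finite_norm unlock => h.
apply: (@lty_poweRy _ _ 2^-1) => //; apply: le_lt_trans h.
rewrite le_eqVlt; apply/orP; left; apply/eqP; congr (_ `^ _)%E.
apply: eq_integral => x _.
by rewrite /comp abse_EFin poweR_EFin powR_mulrn// real_normK// num_real.
Qed.

(** An element of L2 is a class modulo null sets, read as a function through a chosen
    representative. Hence g agrees with f only almost everywhere. *)
Lemma sqint_L2 (f : T -> R) : sqint P f ->
  exists g : LspaceType2 P, (g : T -> R) = f %[ae P].
Proof.
move=> [mf f2].
have mf' : @measurable_fun _ _ T (measurableTypeR R) setT f := mf.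
pose f0 : {mfun T >-> measurableTypeR R} :=
  HB.pack f (isMeasurableFun.Build _ _ _ (measurableTypeR R) f mf').
pose f1 : {mfun_ P, T >-> measurableTypeR R} := (\pi_({mfun_ P, T >-> measurableTypeR R}) f0)%qT.
have e1 : (f1 : T -> R) = f %[ae P].
  have : repr f1 = f0 %[mod {mfun_ P, T >-> measurableTypeR R}]%qT by rewrite reprK.
  by move/eqP; rewrite eqmodE => /asboolP.
have fn : finite_norm P 2 (f1 : T -> R).
  have [mf1 f12] := sqint_ae (measurable_funP (repr f1)) (ae_eq_sym e1) (conj mf f2).
  rewrite /finite_norm unlock; apply: poweR_lty.
  apply: le_lt_trans f12; rewrite le_eqVlt; apply/orP; left; apply/eqP.
  apply: eq_integral => x _.
  by rewrite /comp abse_EFin poweR_EFin powR_mulrn// real_normK// num_real.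
pose g : LspaceType2 P := HB.pack f1 (isFinLebesgue.Build _ _ _ P 2%E (lee1n 2) f1 fn).
by exists g.
Qed.

Lemma inner_ip (f g : LspaceType2 P) : inner f g = ip P f g.
Proof. by []. Qed.

End L2_space.

(** * Existence of orthonormal bases *)

Section orthonormal_basis_existence.
Context d (T : measurableType d) (R : realType).
Variable P : {measure set T -> \bar R}.
Local Notation L2 := (LspaceType2 P).

Lemma ipxx_eq0 (f : T -> R) : sqint P f -> ip P f f = 0 -> f = cst 0 %[ae P].
Proof.
move=> sf f0; have := ipxx sf; rewrite f0 => /esym h.
have : (\int[P]_x `|(f x ^+ 2)%:E| = 0)%E.
  by rewrite -[RHS]h; apply: eq_integral => x _; rewrite /= ger0_norm ?sqr_ge0.
move/(ae_eq_integral_abs P measurableT (measurable_sq sf.1)).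
apply: filterS => x /= /[apply] -[] /eqP; rewrite sqrf_eq0 => /eqP ->.
by [].
Qed.

(** Zorn's lemma gives a maximal orthonormal set A. If some f orthogonal to A were not zero almost
    everywhere, its normalization g would enlarge A. *)
Lemma exists_orthonormal_basis :
  exists (I : choiceType) (e : I -> L2), orthonormal_basis e.
Proof.
pose orth (A : set L2) := forall x y : L2, A x -> A y ->
  inner x y = `[< x = y >]%:R.
have [F Forth Ftot|A [Ao Amax]] := @Zorn_bigcup _ orth.
  move=> x y [X FX Xx] [Y FY Yy]; have [XY|YX] := Ftot _ _ FX FY.
    by apply: (Forth _ FY) => //; apply: XY.
  by apply: (Forth _ FX) => //; apply: YX.
exists {classic {x : L2 | A x}}, (fun i => sval (i : {x : L2 | A x})).
split=> [i j|f fA].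
  rewrite Ao; [|exact: svalP (i : {x : L2 | A x})|exact: svalP (j : {x : L2 | A x})].
  congr (_ %:R); congr nat_of_bool; apply/asboolP/eqP => [ij|->//].
  by case: i j ij => [x Ax] [y Ay] /= xy; exact: eq_exist.
apply: contrapT => f0.
have sf := L2_sqint f.
have ff0 : 0 < ip P f f.
  rewrite lt_neqAle ip_ge0 andbT; apply/negP => /eqP/esym ff; apply: f0.
  exact: ipxx_eq0.
pose c := (Num.sqrt (ip P f f))^-1.
have c0 : c != 0 by rewrite invr_eq0 sqrtr_eq0 -ltNge.
(* The multiple c f is written as c f + 0 so that [sqint_lin] and [ip_lin] apply. *)
have [g gE] := sqint_L2 (sqint_lin c sf (sqint0 P)).
have mg := L2_measurable g.
have gh h : sqint P h -> ip P g h = c * ip P f h.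
  move=> sh; rewrite (ip_ae mg sh.1 _ sh.1 gE (ae_eq_refl _ _ _)); last first.
    by have [] := sqint_lin c sf (sqint0 P).
  rewrite ip_lin//; last exact: sqint0.
  rewrite [X in _ + X](_ : _ = 0) ?addr0//.
  by rewrite /ip; under eq_Rintegral do rewrite mul0r; rewrite /Rintegral integral0.
have gA x : A x -> ip P g x = 0.
  move=> Ax; rewrite gh; last exact: L2_sqint.
  have := fA (exist _ x Ax); rewrite /inner -/(ip P f x) => ->.
  by rewrite mulr0.
have gg : ip P g g = 1.
  rewrite gh; last exact: L2_sqint.
  rewrite ipC gh// mulrA -expr2 exprVn sqr_sqrtr ?mulVf//; last exact: ltW.
  by rewrite gt_eqF.
have nAg : ~ A g.
  by move=> /gA; rewrite gg => /eqP; rewrite oner_eq0.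
apply: (Amax (A `|` [set g])).
  split; first by move=> x Ax; left.
  by move=> /(_ g (or_intror erefl)).
move=> x y [Ax|/= ->] [Ay|/= ->].
- exact: Ao.
- rewrite inner_ip ipC gA//; case: asboolP => // xg.
  by rewrite xg in Ax.
- rewrite inner_ip gA//; case: asboolP => // xg.
  by rewrite -xg in Ay.
- by rewrite inner_ip gg; case: asboolP.
Qed.

End orthonormal_basis_existence.

(** * Integral operators with square-integrable kernels *)

Lemma sqint_norm d (T : measurableType d) (R : realType)
    (mu : {measure set T -> \bar R}) (f : T -> R) :
  sqint mu f -> sqint mu (fun x => `|f x|).
Proof.
move=> [mf f2]; split; first exact: measurableT_comp.
by under eq_integral do rewrite real_normK ?num_real//.
Qed.

Section hilbert_schmidt.
Context d d' (T : measurableType d) (U : measurableType d') (R : realType).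
Variables (P : {sigma_finite_measure set T -> \bar R}).
Variables (rho : {sigma_finite_measure set U -> \bar R}).
Implicit Types (q : U * T -> R).

Definition hs_kernel q := measurable_fun setT q /\
  (\int[rho]_u \int[P]_v (q (u, v) ^+ 2)%:E < +oo)%E.

Definition hs_op q (f : T -> R) (u : U) : R := ip P (fun v => q (u, v)) f.

Definition hs_norm2 q : R := fine (\int[rho]_u \int[P]_v (q (u, v) ^+ 2)%:E)%E.

(** The row integral is the difference of the integrals of the positive and negative parts, each
    measurable in u by Tonelli. This also covers the rows that are not integrable. *)
Lemma measurable_hs_op q f : measurable_fun setT q -> measurable_fun setT f ->
  measurable_fun setT (hs_op q f).
Proof.
move=> mq mf; rewrite /hs_op /ip /Rintegral.
apply: (@measurableT_comp _ _ _ _ _ _ (@fine R)).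
  exact: fine_measurable.
pose F (z : U * T) := (q z * f z.2)%:E.
have mF : measurable_fun setT F.
  apply/measurable_EFinP/measurable_funM => //.
  by apply: (measurableT_comp mf); exact: measurable_snd.
rewrite (_ : (fun u => _) = (fun u => fubini_F P F^\+ u - fubini_F P F^\- u)%E).
  apply: emeasurable_funB; apply: measurable_fun_fubini_tonelli_F => //.
    exact: measurable_funepos.
  exact: measurable_funeneg.
by apply/funext => u; rewrite [LHS]integralE /fubini_F; congr (_ - _)%E;
  apply: eq_integral => v _; rewrite ?funeposE ?funenegE.
Qed.

Section kernel.
Variable q : U * T -> R.
Hypothesis hq : hs_kernel q.
Let mq : measurable_fun setT q := hq.1.

Let mq2 : measurable_fun setT (fun z : U * T => (q z ^+ 2)%:E).
Proof. exact: measurable_sq. Qed.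

Let mF : measurable_fun setT (fun u => \int[P]_v (q (u, v) ^+ 2)%:E)%E.
Proof.
apply: (measurable_fun_fubini_tonelli_F (fun z : U * T => (q z ^+ 2)%:E)) => //.
by move=> z; rewrite lee_fin sqr_ge0.
Qed.

Let F0 u : (0 <= \int[P]_v (q (u, v) ^+ 2)%:E)%E.
Proof. by apply: integral_ge0 => v _; rewrite lee_fin sqr_ge0. Qed.

Lemma hs_row_sqint : {ae rho, forall u, sqint P (fun v => q (u, v))}.
Proof.
have : rho.-integrable setT (fun u => \int[P]_v (q (u, v) ^+ 2)%:E)%E.
  apply/integrableP; split => //.
  by under eq_integral do rewrite gee0_abs//; exact: hq.2.
move/(integrable_ae measurableT); apply: filterS => u /(_ Logic.I) h; split.
  exact: measurable_fun_pair2.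
by rewrite -ge0_fin_numE.
Qed.

Lemma hs_norm2E :
  (hs_norm2 q)%:E = (\int[rho]_u \int[P]_v (q (u, v) ^+ 2)%:E)%E.
Proof.
rewrite fineK// ge0_fin_numE; first exact: hq.2.
by apply: integral_ge0 => u _; exact: F0.
Qed.

Lemma hs_norm2_ge0 : 0 <= hs_norm2 q.
Proof. by rewrite fine_ge0//; apply: integral_ge0 => u _; exact: F0. Qed.

(** Cauchy-Schwarz on almost every row, integrated over u. *)
Lemma hs_op_bound f : sqint P f ->
  (\int[rho]_u (hs_op q f u ^+ 2)%:E <= (hs_norm2 q * ip P f f)%:E)%E.
Proof.
move=> sf; rewrite EFinM hs_norm2E muleC -ge0_integralZl//; last first.
  by rewrite lee_fin ip_ge0.
apply: ae_ge0_le_integral => //.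
- by move=> u _; rewrite lee_fin sqr_ge0.
- by apply: measurable_sq; apply: measurable_hs_op => //; exact: sf.1.
- by move=> u _; rewrite mule_ge0// lee_fin ip_ge0.
- by apply: measurable_funeM.
apply: filterS hs_row_sqint => u su _.
by rewrite -ipxx// -EFinM lee_fin mulrC cauchy_schwarz.
Qed.

Lemma hs_op_sqint f : sqint P f -> sqint rho (hs_op q f).
Proof.
move=> sf; split; first by apply: measurable_hs_op => //; exact: sf.1.
by apply: le_lt_trans (hs_op_bound sf) _; rewrite ltry.
Qed.

Lemma hs_op_norm f : sqint P f ->
  ip rho (hs_op q f) (hs_op q f) <= hs_norm2 q * ip P f f.
Proof. by move=> sf; rewrite -lee_fin ipxx ?hs_op_bound//; exact: hs_op_sqint. Qed.

(** The conclusion holds everywhere: changing f on a null set affects none of the row integrals. *)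
Lemma hs_op_ae f g : measurable_fun setT f -> measurable_fun setT g ->
  f = g %[ae P] -> hs_op q f = hs_op q g.
Proof.
move=> mf mg fg; apply/funext => u; apply: ip_ae => //.
- exact: measurable_fun_pair2.
- exact: measurable_fun_pair2.
- exact: ae_eq_refl.
Qed.

Lemma hs_op_lin (c : R) f g : sqint P f -> sqint P g ->
  hs_op q (fun x => c * f x + g x) = (fun u => c * hs_op q f u + hs_op q g u)
    %[ae rho].
Proof.
move=> sf sg; apply: filterS hs_row_sqint => u su _.
by rewrite /hs_op ipC ip_lin// ipC; congr (_ + _); exact: ipC.
Qed.

(** The number [hs_op q (e i) u] is the coefficient along [e i] of the row q(u, .). Bessel's
    inequality for almost every row is integrated over u. *)
Lemma hs_bessel (I : eqType) (s : seq I) (e : I -> T -> R) :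
  (forall i, sqint P (e i)) ->
  (forall i j, i \in s -> j \in s -> ip P (e i) (e j) = (i == j)%:R) ->
  uniq s ->
  \sum_(i <- s) ip rho (hs_op q (e i)) (hs_op q (e i)) <= hs_norm2 q.
Proof.
move=> se on us; rewrite -lee_fin -sumEFin hs_norm2E.
have sAe i : sqint rho (hs_op q (e i)) by exact: hs_op_sqint.
under eq_bigr do rewrite ipxx//.
have mAe i : measurable_fun setT (fun u => (hs_op q (e i) u ^+ 2)%:E).
  by apply: measurable_sq; exact: (sAe i).1.
rewrite -ge0_integral_sum//=; last by move=> i u _; rewrite lee_fin sqr_ge0.
apply: ae_ge0_le_integral => //.
- by move=> u _; apply: sume_ge0 => i _; rewrite lee_fin sqr_ge0.
- exact: emeasurable_sum.
apply: filterS hs_row_sqint => u su _.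
by rewrite sumEFin -ipxx// lee_fin; apply: bessel.
Qed.

End kernel.

Lemma hs_norm_kernel q : hs_kernel q -> hs_kernel (fun z => `|q z|).
Proof.
move=> [mq q2]; split; first exact: measurableT_comp.
by under eq_integral do under eq_integral do rewrite real_normK ?num_real//.
Qed.

(** With absolute values everywhere, the iterated integral is the inner product of |g| with the
    image of |f| under the operator of kernel |q|. It is finite because both functions are square
    integrable. *)
Lemma hs_integrable q f g : hs_kernel q -> sqint P f -> sqint rho g ->
  (rho \x P)%E.-integrable setT (fun z => (g z.1 * q z * f z.2)%:E).
Proof.
move=> hq sf sg.
have mgf : measurable_fun setT (fun z => (g z.1 * q z * f z.2)%:E).
  apply/measurable_EFinP; apply: measurable_funM.
    by apply: measurable_funM hq.1; apply: (measurableT_comp sg.1); exact: measurable_fst.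
  by apply: (measurableT_comp sf.1); exact: measurable_snd.
apply/integrable12ltyP => //.
have hqa := hs_norm_kernel hq; have sfa := sqint_norm sf; have sga := sqint_norm sg.
have := integrable_lty measurableT (sqint_integrable sga (hs_op_sqint hqa sfa)).
apply: le_lt_trans; apply: ae_ge0_le_integral => //.
- by move=> u _; exact: integral_ge0.
- apply: (measurable_fun_fubini_tonelli_F (fun z => `|(g z.1 * q z * f z.2)%:E|)%E) => //.
  exact: measurableT_comp.
- move=> u _; rewrite lee_fin mulr_ge0//.
  by apply: Rintegral_ge0 => v _; rewrite mulr_ge0.
- apply/measurable_EFinP/measurable_funM; first exact: sga.1.
  exact: (hs_op_sqint hqa sfa).1.
apply: filterS (hs_row_sqint hqa) => u su _.
have i1 := sqint_integrable su sfa.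
rewrite le_eqVlt; apply/orP; left; apply/eqP.
rewrite EFinM /hs_op /ip /Rintegral fineK; last exact: integrable_fin_num.
rewrite -ge0_integralZl//.
- by apply: eq_integral => v _; rewrite /= !normrM -mulrA EFinM.
- exact: measurable_int i1.
Qed.

End hilbert_schmidt.

(** * Adjoints, and the trace of Q* Q for a Hilbert-Schmidt operator Q *)

Section adjoint_kernel.
Context d d' (T : measurableType d) (U : measurableType d') (R : realType).
Variables (P : {sigma_finite_measure set T -> \bar R}).
Variables (rho : {sigma_finite_measure set U -> \bar R}).
Variable q : U * T -> R.
Hypothesis hq : hs_kernel P rho q.

Definition swap_kernel (z : T * U) : R := q (z.2, z.1).

Lemma measurable_swap_kernel : measurable_fun setT swap_kernel.
Proof.
apply: (measurableT_comp hq.1); apply: measurable_fun_pair.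
  exact: measurable_snd.
exact: measurable_fst.
Qed.

Lemma hs_swap_integral :
  (\int[P]_v \int[rho]_u (swap_kernel (v, u) ^+ 2)%:E =
   \int[rho]_u \int[P]_v (q (u, v) ^+ 2)%:E)%E.
Proof.
rewrite (fubini_tonelli (fun z : U * T => (q z ^+ 2)%:E))//.
  by apply: measurable_sq; exact: hq.1.
by move=> z; rewrite lee_fin sqr_ge0.
Qed.

Lemma hs_swap : hs_kernel rho P swap_kernel.
Proof.
split; first exact: measurable_swap_kernel.
by rewrite hs_swap_integral; exact: hq.2.
Qed.

Lemma hs_norm2_swap : hs_norm2 rho P swap_kernel = hs_norm2 P rho q.
Proof. by rewrite /hs_norm2 hs_swap_integral. Qed.

Local Notation q' := swap_kernel.

(* Fubini for g(u) q(u, v) f(v), jointly integrable because q is square integrable. *)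
Lemma hs_adjoint_integrable f g : sqint P f -> sqint rho g ->
  P.-integrable setT (fun v => (\int[rho]_u (g u * q (u, v))%:E * (f v)%:E)%E) /\
  (\int[P]_v (\int[rho]_u (g u * q (u, v))%:E * (f v)%:E) =
   (ip rho g (hs_op P q f))%:E)%E.
Proof.
move=> sf sg.
have hi := hs_integrable hq sf sg.
(* The factor f(v) can be taken out of the integral where q(., v) is square integrable, that is, for
   almost every v. *)
have ae1 : (fun v => \int[rho]_u (g u * q (u, v) * f v)%:E)%E =
    (fun v => \int[rho]_u (g u * q (u, v))%:E * (f v)%:E)%E %[ae P].
  apply: filterS (hs_row_sqint hs_swap) => v sv _.
  by rewrite -integralZr//; apply: sqint_integrable.
have mker : measurable_fun setT
    (fun v => (\int[rho]_u (g u * q (u, v))%:E * (f v)%:E)%E).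
  apply: emeasurable_funM; last by apply/measurable_EFinP; exact: sf.1.
  have mgq : measurable_fun setT (fun z : U * T => (g z.1 * q z)%:E).
    apply/measurable_EFinP; apply: measurable_funM hq.1.
    by apply: (measurableT_comp sg.1); exact: measurable_fst.
  pose F z := (g z.1 * q z)%:E.
  rewrite (_ : (fun v => _) = (fun v => fubini_G rho F^\+ v - fubini_G rho F^\- v)%E).
    apply: emeasurable_funB; apply: measurable_fun_fubini_tonelli_G => //.
      exact: measurable_funepos.
    exact: measurable_funeneg.
  by apply/funext => v; rewrite [LHS]integralE /fubini_G; congr (_ - _)%E;
    apply: eq_integral => u _; rewrite ?funeposE ?funenegE.
have mh : measurable_fun setT (fun z : U * T => (g z.1 * q z * f z.2)%:E).
  exact: measurable_int hi.
have ig : P.-integrable setT (fun v => \int[rho]_u (g u * q (u, v) * f v)%:E)%E.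
  apply/integrableP; split; first exact: (measurable_fubini_G hi).
  apply: le_lt_trans ((integrable21ltyP _ _ mh).1 hi).
  apply: ge0_le_integral => //.
  - by apply: measurableT_comp => //; exact: (measurable_fubini_G hi).
  - apply: (measurable_fun_fubini_tonelli_G
      (fun z => `|(g z.1 * q z * f z.2)%:E|)%E) => //.
    exact: measurableT_comp.
  - by move=> v _; apply: le_abse_integral => //; exact: measurable_fun_pair1 mh.
split.
  apply/integrableP; split => //.
  rewrite -(@ge0_ae_eq_integral _ _ _ P setT
    (fun v => `|\int[rho]_u (g u * q (u, v) * f v)%:E|)%E)//.
  - by have /integrableP[] := ig.
  - by apply: measurableT_comp => //; exact: measurable_int ig.
  - exact: measurableT_comp.
  - by apply: filterS ae1 => v /= /[apply] ->.
transitivity (\int[P]_v \int[rho]_u (g u * q (u, v) * f v)%:E)%E.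
  by apply: ae_eq_integral => //; [exact: measurable_int ig|exact: ae_eq_sym].
rewrite -(Fubini hi) /ip /Rintegral fineK; last first.
  by apply: integrable_fin_num => //; apply: sqint_integrable (hs_op_sqint hq sf).
apply: ae_eq_integral => //.
- by apply: measurable_int (integrable_fubini_F hi).
- apply/measurable_EFinP/measurable_funM; first exact: sg.1.
  exact: (hs_op_sqint hq sf).1.
apply: filterS (hs_row_sqint hq) => u su _ /=.
have i1 := sqint_integrable su sf.
rewrite EFinM /hs_op /ip /Rintegral fineK; last exact: integrable_fin_num.
rewrite -integralZl//.
by apply: eq_integral => v _; rewrite /= -mulrA EFinM.
Qed.

Lemma hs_adjoint f g : sqint P f -> sqint rho g ->
  ip rho g (hs_op P q f) = ip P (hs_op rho q' g) f.
Proof.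
move=> sf sg; apply: EFin_inj; have [i1 <-] := hs_adjoint_integrable sf sg.
rewrite /ip /Rintegral fineK; last first.
  by apply: integrable_fin_num => //; apply: sqint_integrable => //; exact: hs_op_sqint hs_swap _ sg.
apply: ae_eq_integral => //.
- exact: measurable_int i1.
- apply/measurable_EFinP/measurable_funM; last exact: sf.1.
  exact: (hs_op_sqint hs_swap sg).1.
apply: filterS (hs_row_sqint hs_swap) => v sv _ /=.
rewrite EFinM; congr (_ * _)%E; rewrite /hs_op /ip /Rintegral fineK.
  by apply: eq_integral => u _; rewrite mulrC.
by apply: integrable_fin_num => //; exact: sqint_integrable.
Qed.

(** The operator Q* Q, where Q has kernel [q]. *)
Definition hs_sq_op f := hs_op rho q' (hs_op P q f).

Lemma hs_sq_op_sqint f : sqint P f -> sqint P (hs_sq_op f).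
Proof. by move=> sf; apply: (hs_op_sqint hs_swap); exact: hs_op_sqint. Qed.

Lemma hs_sq_op_inner f g : sqint P f -> sqint P g ->
  ip P (hs_sq_op f) g = ip rho (hs_op P q f) (hs_op P q g).
Proof. by move=> sf sg; rewrite -hs_adjoint//; exact: hs_op_sqint. Qed.

(** For almost every v the function g = q(., v) is square integrable, so that
    [hs_adjoint_integrable] applies to it. *)
Lemma hs_sq_op_kernel f : sqint P f -> {ae P, forall v,
  P.-integrable setT
    (fun v' => (\int[rho]_u (q (u, v) * q (u, v'))%:E * (f v')%:E)%E) /\
  (hs_sq_op f v)%:E =
    (\int[P]_v' (\int[rho]_u (q (u, v) * q (u, v'))%:E * (f v')%:E))%E}.
Proof.
move=> sf; apply: filterS (hs_row_sqint hs_swap) => v sv.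
by have [? ->] := hs_adjoint_integrable sf sv.
Qed.

Let L_spec (f : LspaceType2 P) :
  exists g : LspaceType2 P, (g : T -> R) = hs_sq_op f %[ae P].
Proof. by apply: sqint_L2; apply: hs_sq_op_sqint; exact: L2_sqint. Qed.

(** The inner product of L f and g is that of Q f and Q g, which makes L self-adjoint and positive.
    The trace of L is thus the sum of the squared norms of the Q(e_i), bounded by [hs_bessel]. *)
Theorem hs_sq_trace_class : exists L : LspaceType2 P -> LspaceType2 P,
  (forall f : LspaceType2 P, {ae P, forall v,
    P.-integrable setT
      (fun v' => (\int[rho]_u (q (u, v) * q (u, v'))%:E * (f v' : R)%:E)%E) /\
    (L f v : R)%:E =
      (\int[P]_v' (\int[rho]_u (q (u, v) * q (u, v'))%:E * (f v' : R)%:E))%E}) /\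
  trace_class L.
Proof.
have [L LE] := choice L_spec.
exists L; split.
  move=> f; apply: filterS2 (LE f) (hs_sq_op_kernel (L2_sqint f)) => v.
  by move=> -> //.
have inL f g : inner (L f) g = ip rho (hs_op P q f) (hs_op P q g).
  rewrite inner_ip -hs_sq_op_inner; [|exact: L2_sqint..].
  apply: ip_ae (LE f) (ae_eq_refl _ _ _); [exact: L2_measurable..| |].
    exact: (hs_sq_op_sqint (L2_sqint f)).1.
  exact: L2_measurable.
have adjL : adjoint_operator L L.
  by move=> f g; rewrite inL inner_ip [RHS]ipC -[RHS]/(inner (L g) f) inL ipC.
have posL f : 0 <= inner (L f) f by rewrite inL ip_ge0.
have bL : bounded_linear_operator L.
  split.
    move=> c f g r rE.
    have sf := L2_sqint f; have sg := L2_sqint g; have sr := L2_sqint r.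
    have scfg := sqint_lin c sf sg.
    have e1 : hs_op P q r = (fun u => c * hs_op P q f u + hs_op P q g u) %[ae rho].
      rewrite (hs_op_ae hq sr.1 scfg.1 rE).
      exact: hs_op_lin.
    have e2 : hs_sq_op r = hs_op rho q' (fun u => c * hs_op P q f u + hs_op P q g u).
      apply: (hs_op_ae hs_swap) e1; first exact: (hs_op_sqint hq sr).1.
      by have [] := sqint_lin c (hs_op_sqint hq sf) (hs_op_sqint hq sg).
    have e3 := hs_op_lin hs_swap c (hs_op_sqint hq sf) (hs_op_sqint hq sg).
    rewrite -e2 in e3.
    apply: filterS2 (LE r) (filterI e3 (filterI (LE f) (LE g))).
    move=> v hr [h3 [hf hg]] _.
    by rewrite (hr Logic.I) (hf Logic.I) (hg Logic.I); exact: h3 Logic.I.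
  (* Q and its adjoint have operator norm at most the square root of [hs_norm2], whence this bound
     for their composite. *)
  exists (hs_norm2 P rho q) => f.
  have I0 : 0 <= hs_norm2 P rho q by exact: hs_norm2_ge0.
  have sf := L2_sqint f.
  have I2 : hs_norm2 P rho q = Num.sqrt (hs_norm2 P rho q ^+ 2).
    by rewrite sqrtr_sqr ger0_norm.
  rewrite /norm2 {1}I2 -sqrtrM ?sqr_ge0// ler_wsqrtr// !inner_ip.
  have mLf := L2_measurable (L f).
  have mSf := (hs_sq_op_sqint sf).1.
  rewrite (ip_ae mLf mLf mSf mSf (LE f) (LE f)).
  apply: le_trans (hs_op_norm hs_swap (hs_op_sqint hq sf)) _.
  by rewrite hs_norm2_swap expr2 -mulrA ler_wpM2l// hs_op_norm.
(* L is its own adjoint and its own absolute value: the equation S S = L* L reads L L = L L. *)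
split=> //; exists L; first by split=> //; exists L.
have [I [e eo]] := exists_orthonormal_basis P.
exists I, e; split=> //.
apply: (@le_lt_trans _ _ (hs_norm2 P rho q)%:E); last by rewrite ltry.
(* The sum over the basis is the supremum of its finite partial sums, to which [hs_bessel]
   applies. *)
apply: ub_ereal_sup => _ [A [finA _] <-].
rewrite fsbig_finite//= sumEFin lee_fin.
under eq_bigr do rewrite inL.
apply: hs_bessel => //.
- by move=> i; exact: L2_sqint.
- by move=> i j _ _; exact: eo.1.
Qed.

End adjoint_kernel.

(** * Two-block Gibbs samplers *)

Section density.
Import HBNNSimple.
Context d (T : measurableType d) (R : realType).
Variables (mu nu : {measure set T -> \bar R}) (D : set T) (w : T -> R).
Hypothesis mD : measurable D.
Hypothesis mw : measurable_fun D w.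
Hypothesis w0 : forall x, D x -> 0 <= w x.
Hypothesis nuE : forall E, measurable E ->
  nu E = (\int[mu]_(x in E `&` D) (w x)%:E)%E.

Let ge0_integral_density_nnsfun (h : {nnsfun T >-> R}) :
  (\int[nu]_x (h x)%:E = \int[mu]_(x in D) ((h x)%:E * (w x)%:E))%E.
Proof.
transitivity (\sum_(k \in range h) (k%:E * nu (h @^-1` [set k])))%E.
  under eq_integral do rewrite fimfunE -fsumEFin//.
  rewrite ge0_integral_fsum//; last 2 first.
  - by move=> k; apply/measurable_EFinP/measurable_funM.
  - by move=> k x _; rewrite nnfun_muleindic_ge0.
  apply: eq_fsbigr => k _.
  by rewrite integralZl_indic_nnsfun// integral_indic// setIT.
rewrite [RHS](eq_integral (fun x => \sum_(k \in range h)
    ((k * \1_(h @^-1` [set k]) x)%:E * (w x)%:E))%E); last first.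
  move=> x _; rewrite fimfunE -fsumEFin// ge0_mule_fsuml// => k.
  by rewrite nnfun_muleindic_ge0.
rewrite ge0_integral_fsum//; last 2 first.
- move=> k; apply: emeasurable_funM; last exact/measurable_EFinP.
  by apply/measurable_EFinP/measurable_funM.
- move=> k x Dx; rewrite mule_ge0 ?lee_fin ?w0//.
  by have := nnfun_muleindic_ge0 h k x; rewrite lee_fin.
apply: eq_fsbigr => k /[!inE] -[x _ <-].
rewrite nuE// integral_mkcondl -ge0_integralZl//.
- apply: eq_integral => y _; rewrite patchE indicE.
  by case: ifP => _; rewrite ?mulr1 ?mulr0 ?mule0 ?mul0e.
- apply: (eq_measurable_fun (fun y => (w y * \1_(h @^-1` [set h x]) y)%:E)).
    by move=> y _; rewrite patchE indicE; case: ifP => _; rewrite ?mulr1 ?mulr0.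
  by apply/measurable_EFinP/measurable_funM.
- by move=> y Dy; rewrite patchE; case: ifP => _ //; rewrite lee_fin w0.
- by rewrite lee_fin.
Qed.

(** Indicators are the hypothesis [nuE], finite sums over level sets give the simple functions, and
    monotone convergence gives the general case. *)
Lemma ge0_integral_density (f : T -> \bar R) :
  measurable_fun setT f -> (forall x, 0 <= f x)%E ->
  (\int[nu]_x f x = \int[mu]_(x in D) (f x * (w x)%:E))%E.
Proof.
move=> mf f0; pose f_ := nnsfun_approx measurableT mf.
have cf x : ((f_ n x)%:E @[n --> \oo] --> f x)%E.
  by apply: cvg_nnsfun_approx => //.
have ndf x : nondecreasing_seq (fun n => (f_ n x)%:E).
  by move=> m n mn; rewrite lee_fin; exact/lefP/nd_nnsfun_approx.
transitivity (limn (fun n => \int[nu]_x (f_ n x)%:E))%E.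
  rewrite -monotone_convergence//.
  - by apply: eq_integral => x _; apply/esym/cvg_lim.
  - by move=> n; exact/measurable_EFinP.
  - by move=> n x _; rewrite lee_fin.
under eq_fun do rewrite ge0_integral_density_nnsfun.
rewrite -monotone_convergence//.
- apply: eq_integral => x /[!inE] Dx; apply/cvg_lim => //.
  by apply: cvgeZr => //.
- move=> n; apply: emeasurable_funM; first exact/measurable_EFinP/measurable_funTS.
  exact/measurable_EFinP.
- by move=> n x Dx; rewrite mule_ge0 ?lee_fin ?w0.
- by move=> x Dx m n mn; rewrite lee_wpmul2r ?lee_fin ?w0//; exact: ndf.
Qed.

(** As w is nonnegative on D, multiplication by w commutes with taking positive and negative
    parts. *)
Lemma integral_density (f : T -> \bar R) : nu.-integrable setT f ->
  mu.-integrable D (fun x => f x * (w x)%:E)%E /\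
  (\int[nu]_x f x = \int[mu]_(x in D) (f x * (w x)%:E))%E.
Proof.
move=> nf; have mf := measurable_int _ nf.
have mfw : measurable_fun D (fun x => f x * (w x)%:E)%E.
  by apply: emeasurable_funM; [exact: measurable_funTS|exact/measurable_EFinP].
split.
  apply/integrableP; split=> //.
  have /integrableP[_] := nf; rewrite ge0_integral_density//; last exact: measurableT_comp.
  apply: le_lt_trans; rewrite le_eqVlt; apply/orP; left; apply/eqP.
  by apply: eq_integral => x /[!inE] Dx; rewrite abseM (gee0_abs (_ : 0 <= (w x)%:E)%E)// lee_fin w0.
rewrite integralE [RHS]integralE.
rewrite !ge0_integral_density//; [|exact: measurable_funeneg|exact: measurable_funepos].
congr (_ - _)%E; apply: eq_integral => x /[!inE] Dx.
  by rewrite !funeposE muleC (muleC (f x)) maxe_pMr ?lee_fin ?w0// mule0.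
by rewrite !funenegE muleC (muleC (f x)) -muleN maxe_pMr ?lee_fin ?w0// mule0.
Qed.

End density.

(** * The Gibbs operator as Q* Q *)

Section two_block_sampler.
Context d d' (T : measurableType d) (U : measurableType d') (R : realType).
Variables (P nu : {sigma_finite_measure set T -> \bar R}).
Variables (rho : {sigma_finite_measure set U -> \bar R}).
Variables (D : set T) (j : U * T -> R) (Z : R).

Definition marginalU (u : U) : R := \int[nu]_(v in D) j (u, v).
Definition marginalV (v : T) : R := \int[rho]_u j (u, v).
Local Notation G := marginalU.
Local Notation J := marginalV.

Hypothesis mD : measurable D.
Hypothesis mj : measurable_fun setT j.
Hypothesis j0 : forall z, 0 <= j z.
Hypothesis G0 : forall u, 0 < G u.
Hypothesis J0 : forall v, D v -> 0 < J v.
Hypothesis Z0 : 0 < Z.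
Hypothesis PE : forall E, measurable E ->
  P E = (\int[nu]_(v in E `&` D) (J v / Z)%:E)%E.
(** This integral is the squared Hilbert-Schmidt norm of [gibbs_feature], as the proof of
    [hs_gibbs_feature] shows. *)
Hypothesis trace_fin :
  (\int[nu]_(v in D) \int[rho]_u (j (u, v) ^+ 2 / (G u * J v))%:E < +oo)%E.

Lemma measurable_marginalV : measurable_fun setT J.
Proof.
apply: (@measurableT_comp _ _ _ _ _ _ (@fine R)); first exact: fine_measurable.
apply: (measurable_fun_fubini_tonelli_G (EFin \o j)).
  exact/measurable_EFinP.
by move=> z; rewrite lee_fin.
Qed.

Lemma measurable_marginalU : measurable_fun setT G.
Proof.
apply: (@measurableT_comp _ _ _ _ _ _ (@fine R)); first exact: fine_measurable.
under eq_fun do rewrite integral_mkcond.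
rewrite (_ : (fun u => _) = fubini_F nu (fun z => (j z * \1_D z.2)%:E)).
  apply: (measurable_fun_fubini_tonelli_F (fun z : U * T => (j z * \1_D z.2)%:E)).
    apply/measurable_EFinP/measurable_funM => //.
    by apply: measurableT_comp => //; exact: measurable_snd.
  by move=> z; rewrite lee_fin mulr_ge0.
apply/funext => u; apply: eq_integral => v _; rewrite patchE indicE /=.
by case: ifP => _; rewrite ?mulr1 ?mulr0.
Qed.

(* A square root of the Gibbs kernel with respect to the posterior density
   J / Z, see [gibbs_featureM]. *)
Definition gibbs_feature (z : U * T) : R :=
  Num.sqrt Z * j z * \1_D z.2 * G z.1 `^ (- 2^-1) * J z.2 `^ (-1).
Local Notation q := gibbs_feature.

Lemma measurable_gibbs_feature : measurable_fun setT q.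
Proof.
apply: measurable_funM.
  apply: measurable_funM.
    apply: measurable_funM; first exact: measurable_funM.
    by apply: measurableT_comp => //; exact: measurable_snd.
  apply: (@measurableT_comp _ _ _ _ _ _ (@powR R ^~ (- 2^-1))) => //.
  by apply: (measurableT_comp measurable_marginalU); exact: measurable_fst.
apply: (@measurableT_comp _ _ _ _ _ _ (@powR R ^~ (-1))) => //.
by apply: (measurableT_comp measurable_marginalV); exact: measurable_snd.
Qed.

(** The right-hand side is the density of v' given u times that of u given v, whose integral over u
    is the Gibbs kernel. The factor J(v') / Z on the left is the posterior density at v'. *)
Lemma gibbs_featureM u v v' : D v -> D v' ->
  q (u, v) * q (u, v') * (J v' / Z) = j (u, v') / G u * (j (u, v) / J v).
Proof.
move=> Dv Dv'; have Gu := G0 u; have Jv := J0 Dv; have Jv' := J0 Dv'.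
have GG : G u `^ (- 2^-1) * G u `^ (- 2^-1) = (G u)^-1.
  rewrite -powRD; last by apply/implyP => _; rewrite gt_eqF.
  rewrite (_ : - 2^-1 - 2^-1 = -1 :> R); last by lra.
  by rewrite powR_inv1// ltW.
have ZZ : Num.sqrt Z * Num.sqrt Z = Z by rewrite -expr2 sqr_sqrtr// ltW.
rewrite /q /= !indicE !mem_set// !mulr1 !powR_inv1 ?ltW//.
transitivity ((Num.sqrt Z * Num.sqrt Z) * (G u `^ (- 2^-1) * G u `^ (- 2^-1))
   * (j (u, v) * (J v)^-1 * (j (u, v') * (J v')^-1 * (J v' / Z)))); first by ring.
by rewrite ZZ GG; field; rewrite !gt_eqF.
Qed.

Let mw : measurable_fun D (fun v => J v / Z).
Proof.
by apply: measurable_funM => //; apply: measurable_funTS; exact: measurable_marginalV.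
Qed.

Let w0 v : D v -> 0 <= J v / Z.
Proof. by move=> Dv; rewrite divr_ge0// ltW// J0. Qed.

(** After Tonelli and the passage from P to [nu], the case v = v' of [gibbs_featureM] gives the
    integrand of [trace_fin]. *)
Lemma hs_gibbs_feature : hs_kernel P rho q.
Proof.
split; first exact: measurable_gibbs_feature.
have mq2 := measurable_sq measurable_gibbs_feature.
rewrite (fubini_tonelli (fun z : U * T => (q z ^+ 2)%:E))//; last first.
  by move=> z; rewrite lee_fin sqr_ge0.
rewrite (ge0_integral_density mD mw w0 PE); last 2 first.
  apply: (measurable_fun_fubini_tonelli_G (fun z : U * T => (q z ^+ 2)%:E)) => //.
  by move=> z; rewrite lee_fin sqr_ge0.
  by move=> v; apply: integral_ge0 => u _; rewrite lee_fin sqr_ge0.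
apply: le_lt_trans trace_fin; rewrite le_eqVlt; apply/orP; left; apply/eqP.
apply: eq_integral => v /[!inE] Dv; rewrite -ge0_integralZr//.
- apply: eq_integral => u _; rewrite -EFinM expr2 gibbs_featureM//.
  by congr EFin; have Gu := G0 u; have Jv := J0 Dv; field; rewrite !gt_eqF.
- exact: measurable_fun_pair1 mq2.
- by move=> u _; rewrite lee_fin sqr_ge0.
- by rewrite lee_fin w0.
Qed.

Lemma ae_posterior_support : {ae P, forall v, D v}.
Proof.
exists (~` D); split => //; first exact: measurableC.
by rewrite PE ?setICl ?integral_set0//; exact: measurableC.
Qed.

Theorem gibbs_sampler_trace_class :
  exists L : LspaceType2 P -> LspaceType2 P,
  (forall f : LspaceType2 P, {ae P, forall v,
    let k v' := (\int[rho]_u (j (u, v') / G u * (j (u, v) / J v))%:E)%E in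
    nu.-integrable D (fun v' => k v' * (f v' : R)%:E)%E /\
    (L f v : R)%:E = (\int[nu]_(v' in D) (k v' * (f v' : R)%:E))%E}) /\
  trace_class L.
Proof.
have [L [Lk Ltr]] := hs_sq_trace_class hs_gibbs_feature.
exists L; split=> // f; apply: filterS2 (Lk f) ae_posterior_support => v [iv Lv] Dv.
pose k v' := (\int[rho]_u (j (u, v') / G u * (j (u, v) / J v))%:E)%E.
(* The operator Q* Q integrates against P; rewriting this against [nu] brings in the factor J / Z
   that [gibbs_featureM] expects. *)
have [i1 i2] := integral_density mD mw w0 PE iv.
have kE : {in D, (fun v' => \int[rho]_u (q (u, v) * q (u, v'))%:E * (f v' : R)%:E
     * (J v' / Z)%:E)%E =1 (fun v' => k v' * (f v' : R)%:E)%E}.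
  move=> v' /[!inE] Dv'; rewrite muleAC; congr (_ * _)%E.
  rewrite -ge0_integralZr//.
  - by apply: eq_integral => u _; rewrite -EFinM gibbs_featureM.
  - apply/measurable_EFinP/measurable_funM;
      exact: measurable_fun_pair1 measurable_gibbs_feature.
  - move=> u _; rewrite lee_fin /q !mulr_ge0 ?powR_ge0 ?sqrtr_ge0//.
  - by rewrite lee_fin w0.
split; first by apply: eq_integrable i1.
by rewrite Lv i2; apply: eq_integral => v' Dv'; rewrite kE.
Qed.

End two_block_sampler.

(** * Lebesgue measure on R^n *)

Section lebesgue_affine.
Context {R : realType}.
Local Notation leb := (@lebesgue_measure R).

Let phi (l t : R) : measurableTypeR R -> measurableTypeR R := fun x => l * x + t.

Let mphi l t : measurable_fun setT (phi l t).
Proof. by apply: measurable_funD => //; exact: measurable_funM. Qed.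

(** The image of Lebesgue measure under x -> l x + t, multiplied by l, gives half-open intervals
    their length, so it is Lebesgue measure. *)
Lemma integral_affine (l t : R) (f : R -> \bar R) : 0 < l ->
  measurable_fun setT f -> (forall x, 0 <= f x)%E ->
  (\int[leb]_x f (l * x + t)%R = l^-1%:E * \int[leb]_x f x)%E.
Proof.
move=> l0 mf f0.
pose pf := @measure_function_pushforward__canonical__measure_function_Measure
  _ _ _ _ _ leb _ (mphi l t).
have pfE A : measurable A -> leb A = mscale (NngNum (ltW l0)) pf A.
  move=> mA; apply: lebesgue_measure_unique mA => //= _ [[a b]] _ <- /=.
  rewrite /mscale /= /pushforward.
  rewrite (_ : _ @^-1` _ = `](a - t) / l, (b - t) / l]%classic); last first.
    apply/seteqP; split=> x /=; rewrite !in_itv/= ltr_pdivrMr// ler_pdivlMr//;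
      by rewrite /phi ltrBlDr lerBrDr (mulrC l).
  rewrite !lebesgue_measure_itv/= !lte_fin ltr_pM2r ?invr_gt0// ltrD2r.
  case: ifPn => ab; last by rewrite mule0.
  by rewrite -!EFinB -EFinM; congr EFin; field; rewrite gt_eqF.
have -> : (\int[leb]_x f x = \int[mscale (NngNum (ltW l0)) pf]_x f x)%E.
  by apply: eq_measure_integral => A mA _; exact: pfE.
rewrite ge0_integral_mscale//= muleA -EFinM mulVf ?gt_eqF// mul1e.
by rewrite (ge0_integral_pushforward (mphi l t)).
Qed.

End lebesgue_affine.

Section lebesgue_Rn_theory.
Context {R : realType}.
Local Notation leb := (@lebesgue_measure R).
Local Notation lebn := (@lebesgue_Rn R).

Definition cube n k : set (Rn R n) :=
  [set x | forall i, `[- k%:R, k%:R]%classic (tnth x i : R)].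

Lemma measurable_cube n k : measurable (@cube n k).
Proof.
rewrite (_ : cube k = \bigcap_(i in [set: 'I_n])
    ((fun x : Rn R n => tnth x i) @^-1` `[- k%:R, k%:R]%classic)).
  apply: fin_bigcap_measurable => // i _.
  by rewrite -[X in measurable X]setTI; apply: measurable_tnth.
by apply/seteqP; split=> [x cx i _|x cx i]; exact: cx.
Qed.

Lemma lebesgue_Rn_cube n k : (lebn n (@cube n k) < +oo)%E.
Proof.
elim: n => [|n ih].
  by rewrite /lebesgue_Rn/= diracE; case: (_ \in _); rewrite ltry.
rewrite /= /pushforward.
rewrite (_ : _ @^-1` _ = @cube n k `*` `[- k%:R, k%:R]%classic); last first.
  apply/seteqP; split=> [[t x] h|[t x] [/= ht hx] i] /=.
    split=> [i|]; last by have := h ord0; rewrite /cons_Rn tnth0.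
    by have := h (lift ord0 i); rewrite /cons_Rn tnthS.
  case: (unliftP ord0 i) => [j ->|->]; first by rewrite /cons_Rn tnthS; exact: ht.
  by rewrite /cons_Rn tnth0.
rewrite product_measure1E//; last exact: measurable_cube.
pose I := `[- (k%:R : R), k%:R]%classic; have fin : (leb I < +oo)%E.
  by rewrite lebesgue_measure_itv/=; case: ifP => _; rewrite ?ltry.
by rewrite lte_mul_pinfty// ge0_fin_numE.
Qed.

Lemma lebesgue_Rn_sigma_finite n : sigma_finite setT (lebn n).
Proof.
exists (@cube n).
  apply/esym/seteqP; split=> // x _.
  exists (\max_(i < n) Num.truncn `|tnth x i : R|).+1 => // i /=.
  rewrite in_itv/= -ler_norml; apply/ltW.
  apply: (lt_le_trans (truncnS_gt _)); rewrite ler_nat ltnS.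
  exact: (leq_bigmax i).
by move=> k; split; [exact: measurable_cube|exact: lebesgue_Rn_cube].
Qed.

(* [lebesgue_Rn n] is a measure structure, not a function: giving its underlying
   function a name is what lets it carry the sigma-finite structure. *)
Definition leb_Rn n : set (Rn R n) -> \bar R := lebn n.
Arguments leb_Rn n _ : clear implicits.

HB.instance Definition _ n := isMeasure.Build _ _ _ (leb_Rn n)
  (measure0 (lebn n)) (measure_ge0 (lebn n))
  (@measure_semi_sigma_additive _ _ _ (lebn n)).

HB.instance Definition _ n := Measure_isSigmaFinite.Build _ _ _ (leb_Rn n)
  (@lebesgue_Rn_sigma_finite n).

Local Notation mu := leb_Rn.

Lemma integral_leb_RnS n (f : Rn R n.+1 -> \bar R) :
  measurable_fun setT f -> (forall t, 0 <= f t)%E ->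
  (\int[mu n.+1]_t f t = \int[mu n]_t \int[leb]_x f (cons_Rn (t, x)))%E.
Proof.
move=> mf f0.
rewrite [LHS](ge0_integral_pushforward (@measurable_cons_Rn R n))//.
rewrite preimage_setT.
rewrite -(fubini_tonelli1 (m1 := mu n) (m2 := leb) (f \o @cons_Rn R n))//.
  by apply: measurableT_comp => //; exact: measurable_cons_Rn.
by move=> z; exact: f0.
Qed.

Lemma integral_leb_Rn0 (f : Rn R 0 -> \bar R) :
  measurable_fun setT f -> (\int[mu 0]_t f t = f [tuple])%E.
Proof. by move=> mf; rewrite [LHS]integral_dirac// diracT mul1e. Qed.

Lemma integral_leb_Rn_prod n (f : 'I_n -> R -> R) (c : 'I_n -> R) :
  (forall i, measurable_fun setT (f i)) -> (forall i x, 0 <= f i x) ->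
  (forall i, \int[leb]_x (f i x)%:E = (c i)%:E)%E ->
  (\int[mu n]_t (\prod_(i < n) f i (tnth t i))%:E = (\prod_(i < n) c i)%:E)%E.
Proof.
elim: n f c => [|n ih] f c mf f0 fc.
  by under eq_integral do rewrite big_ord0; rewrite integral_leb_Rn0// big_ord0.
have mprod m (g : 'I_m -> R -> R) : (forall i, measurable_fun setT (g i)) ->
    measurable_fun setT (fun t : Rn R m => (\prod_(i < m) g i (tnth t i))%:E).
  move=> mg; apply/measurable_EFinP; apply: measurable_prod => i _.
  by apply: (measurableT_comp (mg i)); exact: measurable_tnth.
rewrite integral_leb_RnS//; last 2 first.
- exact: mprod.
- by move=> t; rewrite lee_fin prodr_ge0.
rewrite big_ord_recl EFinM -(ih (fun i => f (lift ord0 i)) _ _ _ (fun i => fc (lift ord0 i)))//.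
rewrite -ge0_integralZl//; last 3 first.
- exact: (mprod _ (fun i => f (lift ord0 i))).
- by move=> t _; rewrite lee_fin prodr_ge0.
- by rewrite -fc; apply: integral_ge0 => x _; rewrite lee_fin.
apply: eq_integral => t _; rewrite -fc -ge0_integralZr//; last 3 first.
- by have /measurable_EFinP := mf ord0.
- by move=> x _; rewrite lee_fin.
- by rewrite lee_fin prodr_ge0.
apply: eq_integral => x _; rewrite big_ord_recl -EFinM /cons_Rn tnth0.
by congr (_ * _)%:E; apply: eq_bigr => i _; rewrite tnthS.
Qed.

Definition affine_Rn n (l : R) (s t : Rn R n) : Rn R n :=
  [tuple l * (tnth t i : R) + (tnth s i : R) | i < n].

Lemma measurable_affine_Rn n (l : R) (s : Rn R n) :
  measurable_fun setT (affine_Rn l s).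
Proof.
apply/measurable_fun_tnthP => i.
rewrite (_ : _ \o _ = (fun t : Rn R n => l * (tnth t i : R) + (tnth s i : R))); last first.
  by apply/funext => t /=; rewrite tnth_mktuple.
by apply: measurable_funD => //; apply: measurable_funM => //; exact: measurable_tnth.
Qed.

(** Induction on the dimension: the head coordinate contributes one factor 1 / l by
    [integral_affine], and the tail undergoes a map of the same form with shift [behead s]. *)
Lemma integral_affine_Rn n (l : R) (s : Rn R n) (f : Rn R n -> \bar R) :
  0 < l -> measurable_fun setT f -> (forall t, 0 <= f t)%E ->
  (\int[mu n]_t f (affine_Rn l s t) = (l ^- n)%:E * \int[mu n]_t f t)%E.
Proof.
move=> l0; elim: n s f => [|n ih] s f mf f0.
  rewrite !integral_leb_Rn0//; last first.
    by apply: measurableT_comp => //; exact: measurable_affine_Rn.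
  by rewrite expr0 invr1 mul1e; congr f; apply: tuple0.
rewrite !integral_leb_RnS//; last first.
  by apply: measurableT_comp => //; exact: measurable_affine_Rn.
pose g (t : Rn R n) := (\int[leb]_x f (cons_Rn (t, x)))%E.
have mg : measurable_fun setT g.
  apply: (measurable_fun_fubini_tonelli_F (m2 := leb) (f \o @cons_Rn R n)).
    by apply: measurableT_comp => //; exact: measurable_cons_Rn.
  by move=> z; exact: f0.
have g0 t : (0 <= g t)%E by exact: integral_ge0.
transitivity (\int[mu n]_t (l^-1%:E * g (affine_Rn l [tuple of behead s] t)))%E.
  apply: eq_integral => t _; rewrite -(@integral_affine _ l (tnth s ord0))//; last first.
    apply: measurableT_comp => //; apply: (measurableT_comp (@measurable_cons_Rn R n)).
    exact: pair1_measurable.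
  apply: eq_integral => x _; congr f; apply: eq_from_tnth => i.
  rewrite tnth_mktuple; case: (unliftP ord0 i) => [k ->|->].
    by rewrite /cons_Rn !tnthS tnth_mktuple tnth_behead; congr (_ + tnth _ _);
      apply/val_inj; rewrite /= inordK// /bump ltnS ltn_ord.
  by rewrite /cons_Rn !tnth0.
rewrite ge0_integralZl//; last 2 first.
- by apply: measurableT_comp => //; exact: measurable_affine_Rn.
- by rewrite lee_fin invr_ge0 ltW.
by rewrite ih// muleA -EFinM exprS invfM.
Qed.

End lebesgue_Rn_theory.

Arguments leb_Rn {R} n _.

(** * One-dimensional estimates for the GIG mixture *)

Section powers_and_exponentials.
Context {R : realType}.
Local Notation leb := (@lebesgue_measure R).
Implicit Types a b c q t : R.

(** The sublinear bound on the logarithm is applied at k t, with k so small that |q| k <= c. *)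
Lemma powR_le_expR q c : 0 < c ->
  exists C, forall t, 1 <= t -> t `^ q <= expR (C + c * t).
Proof.
move=> c0; pose k := c / (`|q| + 1).
have q1 : 0 < `|q| + 1 by rewrite ltr_wpDl.
have k0 : 0 < k by rewrite divr_gt0.
exists (`|q| * `|ln k|) => t t1; have t0 : 0 < t by apply: lt_le_trans t1.
rewrite /powR gt_eqF// ler_expR.
have lnt0 := ln_ge0 t1.
have h : ln t <= k * t + `|ln k|.
  have := ln_sublinear (mulr_gt0 k0 t0); rewrite lnM ?posrE// => h.
  by have := ler_norm (- ln k); rewrite normrN; lra.
have h1 : q * ln t <= `|q| * ln t by rewrite ler_wpM2r// ler_norm.
apply: (le_trans h1); apply: (le_trans (ler_wpM2l (normr_ge0 q) h)).
have h2 : `|q| * k <= c.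
  by rewrite /k mulrCA ger_pMr// ler_pdivrMr// mul1r lerDl.
by have := ler_wpM2r (ltW t0) h2; rewrite mulrDr; lra.
Qed.

Lemma powR_ge_expR q c : 0 < c ->
  exists C, forall t, 1 <= t -> expR (- (C + c * t)) <= t `^ q.
Proof.
move=> c0; have [C HC] := powR_le_expR (- q) c0; exists C => t t1.
have t0 : 0 < t by apply: lt_le_trans t1.
rewrite expRN -[leRHS]invrK -powRN lef_pV2 ?posrE ?expR_gt0 ?powR_gt0//.
exact: HC.
Qed.

(** The substitution s = 1 / t turns this into [powR_le_expR] at the exponent -q. *)
Lemma powR_inv_exp_bounded q b : 0 < b ->
  exists C, forall t, 0 < t -> t <= 1 -> t `^ q * expR (- (b * t `^ (-1))) <= C.
Proof.
move=> b0; have [C HC] := powR_le_expR (- q) b0; exists (expR C) => t t0 t1.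
rewrite powR_inv1; last exact: ltW.
have s1 : 1 <= t^-1 by rewrite invf_ge1.
rewrite -[t in t `^ q]invrK -powR_inv1 ?invr_ge0 ?(ltW t0)// -powRrM mulN1r.
apply: (le_trans (ler_wpM2r (expR_ge0 _) (HC _ s1))).
by rewrite -expRD addrK.
Qed.

(** The half-open interval is exhausted by the intervals [1 / (n + 1), 1]. On these the primitive
    t^(q+1) / (q+1) bounds the integral by 1 / (q+1), uniformly in n. *)
Lemma integral_powR_lty q : -1 < q ->
  (\int[leb]_(t in `]0%R, 1%R]) (t `^ q)%:E < +oo)%E.
Proof.
move=> q1; have q0 : 0 < q + 1 by lra.
pose F (n : nat) : set R := `[n.+1%:R^-1, 1]%classic.
have -> : `]0%R, 1%R]%classic = \bigcup_n F n.
  apply/seteqP; split=> [t /=|t [n _]].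
    rewrite !in_itv/= => /andP[t0 t1]; exists (Num.truncn t^-1) => //=.
    rewrite /F /= in_itv/= t1 andbT invf_ple ?posrE//.
    by apply: ltW; exact: truncnS_gt.
  rewrite /F /= !in_itv/= => /andP[nt ->]; rewrite andbT.
  by apply: lt_le_trans nt; rewrite invr_gt0.
have mf D : measurable_fun D (fun t => (t `^ q)%:E).
  by apply: measurable_funTS; apply/measurable_EFinP; exact: measurable_powR.
have cv : (\int[leb]_(t in F n) (t `^ q)%:E @[n --> \oo] -->
    \int[leb]_(t in \bigcup_n F n) (t `^ q)%:E)%E.
  apply: ge0_nondecreasing_set_cvg_integral => //.
  - move=> n m nm; apply/subsetPset => t; rewrite /F /= !in_itv/= => /andP[nt ->].
    rewrite andbT; apply: le_trans nt.
    by rewrite lef_pV2 ?posrE// ler_nat ltnS.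
  - by move=> n; exact: measurable_itv.
  - by move=> n; exact: mf.
  - by move=> n t _; rewrite lee_fin powR_ge0.
suff bd n : (\int[leb]_(t in F n) (t `^ q)%:E <= ((q + 1)^-1)%:E)%E.
  rewrite -(cvg_lim _ cv)//; apply: (@le_lt_trans _ _ ((q + 1)^-1)%:E); last by rewrite ltry.
  by apply: lime_le; [apply/cvg_ex; eexists; exact: cv|apply: nearW].
(* For n = 0 the interval is the single point 1, which the fundamental theorem of calculus does not
   cover. *)
have [->|n0] := eqVneq n 0%N.
  rewrite /F invr1 set_itv1 integral_set1 lee_fin invr_ge0; lra.
have c0 : 0 < n.+1%:R^-1 :> R by rewrite invr_gt0.
have c1 : n.+1%:R^-1 < 1 :> R by rewrite invf_lt1// ltr1n ltnS lt0n.
pose G t := (q + 1)^-1 * t `^ (q + 1).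
have dG t : 0 < t -> is_derive t 1 G (t `^ q).
  move=> t0; have := is_derive1_powR (q + 1) t0; rewrite addrK => h.
  by apply: is_derive_eq; rewrite /GRing.scale/= mulrA mulVf ?gt_eqF// mul1r.
have cG t : 0 < t -> {for t, continuous G}.
  move=> t0; apply: differentiable_continuous; apply/derivable1_diffP.
  by have [] := dG _ t0.
rewrite (@continuous_FTC2 _ (fun t => t `^ q) G)//.
- rewrite -EFinB lee_fin /G powR1 mulr1 gerBl mulr_ge0 ?invr_ge0 ?powR_ge0//.
  exact: ltW.
- apply: derivable_within_continuous => t; rewrite in_itv/= => /andP[tc _].
  apply: derivable_powR; rewrite in_itv/= andbT.
  exact: lt_le_trans tc.
- split.
  + move=> t; rewrite in_itv/= => /andP[tc _]; have t0 := lt_trans c0 tc.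
    by have [] := dG _ t0.
  + by apply: cvg_at_right_filter; exact: cG.
  + by apply: cvg_at_left_filter; exact: cG.
- move=> t; rewrite in_itv/= => /andP[tc _]; have t0 := lt_trans c0 tc.
  by rewrite derive1E; have [_ ->] := dG _ t0.
Qed.

(** The exponential density c exp(-c t) has total mass 1. *)
Lemma integral_expR_lty c : 0 < c ->
  (\int[leb]_(t in `[0%R, +oo[) (expR (- (c * t)))%:E < +oo)%E.
Proof.
move=> c0; have := integral_exponential_pdf c0.
rewrite /exponential_pdf.
rewrite [X in X = _](_ : _ =
    \int[leb]_(t in `[0%R, +oo[) (c * expR (- c * t))%:E)%E; last first.
  rewrite [RHS]integral_mkcond; apply: eq_integral => t _.
  by rewrite !patchE; case: ifP.
move=> h.
have mE : measurable_fun (`[0%R, +oo[%classic : set R) (fun t => (expR (- (c * t)))%:E).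
  apply: measurable_funTS; apply/measurable_EFinP; apply: measurableT_comp => //.
  by apply: measurableT_comp => //; exact: measurable_funM.
suff : (c%:E * \int[leb]_(t in `[0%R, +oo[) (expR (- (c * t)))%:E = 1)%E.
  case: (\int[leb]_(t in `[0%R, +oo[) _)%E => [r| |]; rewrite ?ltry//.
  by rewrite mulry gtr0_sg// mul1e.
rewrite -ge0_integralZl//.
- by rewrite -h; apply: eq_integral => t _; rewrite -EFinM mulNr.
- by rewrite lee_fin ltW.
Qed.

End powers_and_exponentials.

(** * The joint density of one coordinate and its mixing variable *)

Section gig_estimates.
Context {R : realType}.
Local Notation leb := (@lebesgue_measure R).

Lemma integral_cst_unit (I : set R) (c : R) : measurable I -> leb I = 1%E ->
  (\int[leb]_(t in I) (cst c%:E t) = c%:E)%E.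
Proof. by move=> mI I1; rewrite integral_cst// -[RHS]mule1 -I1. Qed.

(** At k = A and d = 0 the inequality holds to first order in e because B < A. The margin D left for
    a suitable e pays half for raising k above A and half for making d positive. The contraction
    factor will be 1 - e. *)
Lemma contraction_parameters (A B : R) : 0 <= B -> B < A ->
  exists e k d, [/\ 0 < e, e < 1, A < k, 0 < d &
    (k + e * B) ^+ 2 <= (1 + 2 * e - e ^+ 2) * (A ^+ 2 - 2 * d)].
Proof.
move=> B0 BA; have A0 : 0 < A by apply: le_lt_trans BA.
(* D is half of the first-order gain 2 e A (A - B); this e makes the second-order loss e^2 (A^2 +
   B^2) at most the other half. *)
pose e := (A - B) / (2 * A); pose D := e * A * (A - B).
have e0 : 0 < e by rewrite divr_gt0 ?mulr_gt0// subr_gt0.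
have e1 : e <= 2^-1.
  by rewrite /e ler_pdivrMr ?mulr_gt0//; lra.
have D0 : 0 < D by apply: mulr_gt0; [exact: mulr_gt0|rewrite subr_gt0].
have eA : 2 * A * e = A - B by rewrite /e; field; rewrite gt_eqF.
have H1 : (A + e * B) ^+ 2 + D <= A ^+ 2 * (1 + 2 * e - e ^+ 2).
  have h : e * (A ^+ 2 + B ^+ 2) <= A * (A - B).
    rewrite -eA; have : B ^+ 2 <= A ^+ 2 by rewrite ler_sqr ?nnegrE// ltW.
    move/(ler_wpM2l (ltW e0)); lra.
  have := ler_wpM2l (ltW e0) h; rewrite /D; lra.
(* Replacing A by A + eps on the left costs at most eps (4 A + 1 + D) = D / 2, since e B <= A and
   eps <= 1. *)
pose eps := D / (2 * (4 * A + 1 + D)).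
have den : 0 < 2 * (4 * A + 1 + D) by lra.
have eps0 : 0 < eps by rewrite divr_gt0.
have epsD : eps * (2 * (4 * A + 1 + D)) = D by rewrite /eps divfK// gt_eqF.
have eps1 : eps <= 1.
  by rewrite /eps ler_pdivrMr//; lra.
exists e, (A + eps), (D / 8); split => //; try lra.
have eB : e * B <= A.
  have : e * B <= 1 * A by apply: ler_pM => //; lra.
  by rewrite mul1r.
have eB0 : 0 <= e * B by rewrite mulr_ge0// ltW.
have H2 : (A + eps + e * B) ^+ 2 <= (A + e * B) ^+ 2 + D / 2.
  have h1 : eps * (2 * (A + e * B) + eps) <= eps * (4 * A + 1 + D).
    by rewrite ler_wpM2l//; lra.
  have -> : (A + eps + e * B) ^+ 2 =
    (A + e * B) ^+ 2 + eps * (2 * (A + e * B) + eps) by ring.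
  lra.
have H3 : (1 + 2 * e - e ^+ 2) * (2 * (D / 8)) <= D / 2.
  have h2 : 1 + 2 * e - e ^+ 2 <= 2 by have := sqr_ge0 e; lra.
  by have := ler_wpM2r (ltW D0) h2; lra.
by rewrite mulrBr; lra.
Qed.

(* With s = x / sigma, b = mu / sigma and A^2 - b^2 the first GIG parameter, the
   left-hand side is twice the exponent of
   joint1(x, t)^2 / (joint1((1 - e) x, t) exp(b s - k |s|)), up to the term in 1 / t. *)
Lemma contraction_exponent (A B e k d : R) : 0 <= B -> 0 < e -> e < 1 ->
  (k + e * B) ^+ 2 <= (1 + 2 * e - e ^+ 2) * (A ^+ 2 - 2 * d) ->
  0 <= k ->
  forall b s t, `|b| = B -> 0 < t ->
  (((1 - e) * s - b * t) ^+ 2 - 2 * (s - b * t) ^+ 2) * t^-1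
    - (A ^+ 2 - b ^+ 2) * t + 2 * k * `|s| - 2 * b * s <= - (2 * d * t).
Proof.
move=> B0 e0 e1 H k0 b s t bB t0.
set c := 1 + 2 * e - e ^+ 2 in H *.
have c0 : 0 < c.
  rewrite /c; have : e ^+ 2 <= e by rewrite expr2 ger_pMr// ltW.
  lra.
rewrite -subr_ge0.
rewrite (_ : _ - _ = (c * s ^+ 2 - 2 * e * (b * s) * t - 2 * k * `|s| * t +
    (A ^+ 2 - 2 * d) * t ^+ 2) / t); last first.
  by rewrite /c; field; rewrite gt_eqF.
rewrite divr_ge0 ?(ltW t0)//.
have bs : b * s <= B * `|s| by rewrite -bB -normrM ler_norm.
(* The numerator is a quadratic form in |s| and t. Multiplied by c, it is at least (c |s| - (k + e
   B) t)^2 + (c (A^2 - 2 d) - (k + e B)^2) t^2, where the second coefficient is nonnegative by H. *)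
rewrite -(pmulr_rge0 _ c0).
have h1 : e * t * (b * s) <= e * t * (B * `|s|).
  by rewrite ler_wpM2l// mulr_ge0// ltW.
have h2 := ler_wpM2r (sqr_ge0 t) H.
have h3 := sqr_ge0 (c * `|s| - (k + e * B) * t).
have h4 : `|s| ^+ 2 = s ^+ 2 by rewrite real_normK ?num_real.
have h5 := ler_wpM2l (ltW c0) h1.
move: h3; rewrite sqrrB !exprMn h4 => h3.
lra.
Qed.

Variables (q a b mu sg : R).
Hypotheses (a0 : 0 < a) (b0 : 0 <= b) (sg0 : 0 < sg).
Hypothesis bq : 0 < b \/ -1 < q.

(* The joint density of one latent coordinate [x] and its mixing variable
   [t > 0], up to a constant; [t `^ (-1)] stands for the inverse because
   [powR] is known to be measurable. *)
Definition joint1 (x t : R) : R := t `^ q *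
  expR (- (2^-1 * (((x - mu * t) ^+ 2 / sg ^+ 2 + b) * t `^ (-1) + a * t))).

Definition weight1 (d t : R) : R :=
  t `^ q * expR (- (2^-1 * b * t `^ (-1) + d * t)).

Definition marginal1 (x : R) : R := \int[leb]_(t in `]0, +oo[) joint1 x t.

Lemma measurable_weight1 d : measurable_fun setT (weight1 d).
Proof.
apply: measurable_funM; first exact: measurable_powR.
apply: measurableT_comp => //; apply: measurableT_comp => //.
apply: measurable_funD; apply: measurable_funM => //; exact: measurable_powR.
Qed.

Lemma measurable_joint1 x : measurable_fun setT (joint1 x).
Proof.
apply: measurable_funM; first exact: measurable_powR.
apply: measurableT_comp => //; apply: measurableT_comp => //.
apply: measurable_funM => //; apply: measurable_funD; last exact: measurable_funM.
apply: measurable_funM; last exact: measurable_powR.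
apply: measurable_funD => //; apply: measurable_funM => //.
by apply: measurable_funX; apply: measurable_funB => //; exact: measurable_funM.
Qed.

Lemma joint1_gt0 x t : 0 < t -> 0 < joint1 x t.
Proof. by move=> t0; rewrite mulr_gt0 ?powR_gt0 ?expR_gt0. Qed.

Lemma joint1_ge0 x t : 0 <= joint1 x t.
Proof. by rewrite mulr_ge0 ?powR_ge0 ?expR_ge0. Qed.

Lemma weight1_ge0 d t : 0 <= weight1 d t.
Proof. by rewrite mulr_ge0 ?powR_ge0 ?expR_ge0. Qed.

Let mwD d (D : set R) : measurable_fun D (fun t => (weight1 d t)%:E).
Proof. by apply: measurable_funTS; apply/measurable_EFinP; exact: measurable_weight1. Qed.

Let w0 d t : (0 <= (weight1 d t)%:E)%E.
Proof. by rewrite lee_fin weight1_ge0. Qed.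

(** Near 0, either b > 0 and the exponential in 1 / t keeps the integrand bounded, or q > -1 and the
    power is integrable. *)
Lemma integral_weight1_lty01 d : 0 < d ->
  (\int[leb]_(t in `]0%R, 1%R]) (weight1 d t)%:E < +oo)%E.
Proof.
move=> d0; case: bq => [bp|q1].
  have b2 : 0 < 2^-1 * b by rewrite mulr_gt0// invr_gt0.
  have [C HC] := powR_inv_exp_bounded q b2.
  apply: (@le_lt_trans _ _ (\int[leb]_(t in `]0%R, 1%R]) (cst C%:E t))%E).
    apply: ge0_le_integral => //; first exact: mwD.
    move=> t; rewrite /= in_itv/= => /andP[t0 t1]; rewrite lee_fin.
    apply: le_trans (HC _ t0 t1); rewrite ler_wpM2l ?powR_ge0// ler_expR.
    by rewrite lerN2 lerDl mulr_ge0// ltW.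
  rewrite integral_cst_unit ?ltry// lebesgue_measure_itv/= lte_fin ltr01.
  by rewrite oppr0 adde0.
apply: le_lt_trans (integral_powR_lty q1); apply: ge0_le_integral => //.
- exact: mwD.
- by apply: measurable_funTS; apply/measurable_EFinP; exact: measurable_powR.
move=> t; rewrite /= in_itv/= => /andP[t0 t1]; rewrite lee_fin.
rewrite ler_piMr ?powR_ge0// expR_le1 oppr_le0 addr_ge0 ?mulr_ge0 ?powR_ge0//.
  exact: ltW.
exact: ltW.
Qed.

(** Half of the rate d absorbs the power of t; the other half leaves an integrable exponential. *)
Lemma integral_weight1_lty1y d : 0 < d ->
  (\int[leb]_(t in `]1%R, +oo[) (weight1 d t)%:E < +oo)%E.
Proof.
move=> d0; have d2 : 0 < d / 2 by rewrite divr_gt0.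
have [C HC] := powR_le_expR q d2.
have mE D : measurable_fun D (fun t : R => (expR (- (d / 2 * t)))%:E).
  apply: measurable_funTS; apply/measurable_EFinP; apply: measurableT_comp => //.
  by apply: measurableT_comp => //; exact: measurable_funM.
apply: (@le_lt_trans _ _ ((expR C)%:E *
    \int[leb]_(t in `[0%R, +oo[) (expR (- (d / 2 * t)))%:E)%E); last first.
  by rewrite lte_mul_pinfty ?lee_fin ?expR_ge0// integral_expR_lty.
rewrite -ge0_integralZl//; last exact: mE.
apply: (@le_trans _ _ (\int[leb]_(t in `]1%R, +oo[)
    ((expR C)%:E * (expR (- (d / 2 * t)))%:E))%E).
  apply: ge0_le_integral => //; first exact: mwD.
    by apply: measurable_funeM; exact: mE.
  move=> t; rewrite /= in_itv/= andbT => t1; rewrite -EFinM lee_fin.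
  apply: le_trans (ler_wpM2r (expR_ge0 _) (HC _ (ltW t1))) _.
  rewrite -!expRD ler_expR.
  have : 0 <= 2^-1 * b * t `^ (-1) by rewrite !mulr_ge0 ?powR_ge0// invr_ge0.
  lra.
apply: ge0_subset_integral => //; first by apply: measurable_funeM; exact: mE.
by move=> t /=; rewrite !in_itv/= !andbT => /ltW; apply: le_trans.
Qed.

Lemma integral_weight1_lty d : 0 < d ->
  (\int[leb]_(t in `]0%R, +oo[) (weight1 d t)%:E < +oo)%E.
Proof.
move=> d0; rewrite (_ : `]0, +oo[%classic = `]0, 1] `|` `]1, +oo[)%classic; last first.
  apply/seteqP; split=> t /=; rewrite !in_itv/= !andbT.
    by move=> t0; case: (leP t 1) => t1; [left|right] => //; rewrite t0.
  by case=> [/andP[]//|]; apply: lt_trans.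
rewrite ge0_integral_setU//=; last 2 first.
- exact: mwD.
- apply/eqP; rewrite -subset0 => t [] /=; rewrite !in_itv/= andbT.
  by move=> /andP[_ t1]; rewrite ltNge t1.
by apply: lte_add_pinfty; [exact: integral_weight1_lty01|exact: integral_weight1_lty1y].
Qed.

(** Of the expanded square only the cross term is kept, which after division by t is constant in t;
    the two squares only decrease the exponential. *)
Lemma joint1_le_weight1 x t : 0 < t ->
  joint1 x t <= expR (x * mu / sg ^+ 2) * weight1 (a / 2) t.
Proof.
move=> t0; rewrite /weight1 mulrCA ler_wpM2l ?powR_ge0// -expRD ler_expR.
rewrite powR_inv1 ?(ltW t0)// -subr_ge0.
rewrite (_ : _ - _ = (x ^+ 2 + (mu * t) ^+ 2) / (2 * sg ^+ 2 * t)); last first.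
  by field; rewrite !gt_eqF.
by rewrite divr_ge0 ?addr_ge0 ?sqr_ge0// !mulr_ge0// ltW// exprn_gt0.
Qed.

Let mjD x (D : set R) : measurable_fun D (fun t => (joint1 x t)%:E).
Proof. by apply: measurable_funTS; apply/measurable_EFinP; exact: measurable_joint1. Qed.

Lemma marginal1E x :
  (\int[leb]_(t in `]0%R, +oo[) (joint1 x t)%:E = (marginal1 x)%:E)%E.
Proof.
rewrite /marginal1 /Rintegral fineK// ge0_fin_numE; last first.
  by apply: integral_ge0 => t _; rewrite lee_fin joint1_ge0.
have a2 : 0 < a / 2 by rewrite divr_gt0.
apply: (@le_lt_trans _ _ ((expR (x * mu / sg ^+ 2))%:E *
    \int[leb]_(t in `]0%R, +oo[) (weight1 (a / 2) t)%:E)%E); last first.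
  by rewrite lte_mul_pinfty ?lee_fin ?expR_ge0// integral_weight1_lty.
rewrite -ge0_integralZl//; last exact: mwD.
apply: ge0_le_integral => //.
- by move=> t _; rewrite lee_fin joint1_ge0.
- exact: mjD.
- by apply: measurable_funeM; exact: mwD.
by move=> t; rewrite /= in_itv/= andbT => t0; rewrite -EFinM lee_fin joint1_le_weight1.
Qed.

Let A := Num.sqrt (a + mu ^+ 2 / sg ^+ 2).

Let al0 : 0 < a + mu ^+ 2 / sg ^+ 2.
Proof. by rewrite ltr_wpDr// divr_ge0 ?sqr_ge0. Qed.

Let A0 : 0 < A. Proof. by rewrite sqrtr_gt0. Qed.

Let AA : A ^+ 2 = a + mu ^+ 2 / sg ^+ 2. Proof. by rewrite sqr_sqrtr// ltW. Qed.

(* The exponent -(s^2 / t + A^2 t) / 2, where s = x / sg, peaks at t = |s| / A: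
   integrate over a unit interval next to this point. *)
Lemma marginal1_ge k : A < k -> exists C, forall x,
  expR (- (C + k * `|x / sg|) + mu / sg * (x / sg)) <= marginal1 x.
Proof.
(* As A t will be about |s|, bounding t^q below at the rate A (k - A) costs (k - A) |s|. With the A
   |s| lost in the Gaussian exponent this makes k |s|. *)
move=> Ak; have kA : 0 < A * (k - A) by rewrite mulr_gt0// subr_gt0.
have [C HC] := powR_ge_expR q kA.
exists (C + 2 * A * (k - A) + 2^-1 * b + A ^+ 2) => x.
set s := x / sg; pose r := `|s| / A + 1.
(* The shift by 1 keeps the interval inside t >= 1, where [powR_ge_expR] applies; on it A t lies
   between |s| + A and |s| + 2 A. *)
have r1 : 1 <= r by rewrite /r lerDr divr_ge0// ltW.
rewrite -lee_fin -marginal1E; set c := expR _.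
pose I : set R := `[r, r + 1]%classic.
have I1 : leb I = 1%E.
  by rewrite lebesgue_measure_itv/= lte_fin ltrDl ltr01 -EFinB addrAC subrr add0r.
have mI : measurable I by exact: measurable_itv.
rewrite -(integral_cst_unit c mI I1).
apply: (@le_trans _ _ (\int[leb]_(t in I) (joint1 x t)%:E)%E).
  apply: ge0_le_integral => //.
  - by move=> t _; rewrite /= lee_fin expR_ge0.
  - exact: mjD.
  move=> t; rewrite /I /= in_itv/= => /andP[rt tr]; rewrite lee_fin.
  have t1 : 1 <= t by apply: le_trans rt.
  have t0 : 0 < t by apply: lt_le_trans t1.
  apply: le_trans (ler_wpM2r (expR_ge0 _) (HC _ t1)).
  rewrite -expRD ler_expR powR_inv1 ?(ltW t0)//.
  have tA : A * t <= `|s| + 2 * A.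
    have := ler_wpM2l (ltW A0) tr; rewrite /r !mulrDr mulrCA divff ?gt_eqF// mulr1; lra.
  have st : `|s| <= A * t.
    have := ler_wpM2l (ltW A0) rt; rewrite /r !mulrDr mulrCA divff ?gt_eqF// mulr1; lra.
  have sst : s ^+ 2 / t <= A * `|s|.
    rewrite ler_pdivrMr// -(real_normK (num_real s)) expr2.
    by have := ler_wpM2l (normr_ge0 s) st; lra.
  have bt : b / t <= b by rewrite ler_pdivrMr// ler_peMr.
  have h1 : A * (A * t) <= A * (`|s| + 2 * A) by rewrite ler_wpM2l// ltW.
  have h2 : (k - A) * (A * t) <= (k - A) * (`|s| + 2 * A).
    by rewrite ler_wpM2l// ltW// subr_gt0.
  have -> : ((x - mu * t) ^+ 2 / sg ^+ 2 + b) / t + a * t =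
      s ^+ 2 / t + b / t - 2 * (mu / sg * s) + A * (A * t).
    rewrite [A * (A * t)]mulrA -expr2 AA /s; field; rewrite !gt_eqF//.
  lra.
apply: ge0_subset_integral => //; first exact: mjD.
- by move=> t _; rewrite lee_fin joint1_ge0.
- move=> t; rewrite /I /= !in_itv/= andbT => /andP[rt _].
  by apply: lt_le_trans rt; lra.
Qed.

Lemma marginal1_gt0 x : 0 < marginal1 x.
Proof.
have [C HC] := @marginal1_ge (A + 1) ltac:(by rewrite ltrDl).
by apply: lt_le_trans (HC x); rewrite expR_gt0.
Qed.

(* Dividing by [marginal1 x] costs a factor exp(k |x| / sg), which is recovered
   by contracting x to l x in one of the two copies of [joint1]. *)
Lemma joint1_sqr_le : exists l d C, [/\ 0 < l, l <= 1, 0 < d, 0 <= C &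
  forall x t, 0 < t ->
    joint1 x t ^+ 2 <= C * marginal1 x * joint1 (l * x) t * weight1 d t].
Proof.
(* Here a > 0 enters, through A^2 = a + (mu / sg)^2. *)
have BA : `|mu / sg| < A.
  rewrite -sqrtr_sqr ltr_sqrt// expr_div_n ltrDr; exact: a0.
have [e [k [d [e0 e1 Ak d0 H]]]] := contraction_parameters (normr_ge0 _) BA.
have k0 : 0 <= k by apply: ltW; apply: lt_trans Ak.
have [C HC] := marginal1_ge Ak.
exists (1 - e), d, (expR C); split => //.
- by rewrite subr_gt0.
- by rewrite gerBl ltW.
move=> x t t0.
have /= := contraction_exponent (normr_ge0 _) e0 e1 H k0 (x / sg) erefl t0.
rewrite AA => h.
apply: (@le_trans _ _ (expR C * expR (- (C + k * `|x / sg|) + mu / sg * (x / sg)) *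
   joint1 ((1 - e) * x) t * weight1 d t)); last first.
  rewrite ler_wpM2r ?weight1_ge0// ler_wpM2r ?joint1_ge0// ler_wpM2l ?expR_ge0//.
set E := expR (- (C + _) + _).
rewrite /joint1 /weight1 exprMn -expRM_natl.
rewrite (_ : _ * _ * _ * _ = (t `^ q) ^+ 2 * (expR C * E * expR (- (2^-1 *
  ((((1 - e) * x - mu * t) ^+ 2 / sg ^+ 2 + b) * t `^ (-1) + a * t))) *
  expR (- (2^-1 * b * t `^ (-1) + d * t)))); last by ring.
rewrite ler_wpM2l ?sqr_ge0// /E -!expRD ler_expR powR_inv1 ?(ltW t0)//.
rewrite -subr_ge0; move: h; rewrite -subr_ge0 => h.
rewrite (_ : _ - _ = 2^-1 * (- (2 * d * t) -
   ((((1 - e) * (x / sg) - mu / sg * t) ^+ 2 - 2 * (x / sg - mu / sg * t) ^+ 2) / t -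
    (a + mu ^+ 2 / sg ^+ 2 - (mu / sg) ^+ 2) * t + 2 * k * `|x / sg| -
    2 * (mu / sg) * (x / sg)))).
  by rewrite mulr_ge0// invr_ge0.
by field; rewrite !gt_eqF.
Qed.

End gig_estimates.

Lemma measurable_inv_ge0 d (T : measurableType d) (R : realType) (f : T -> R) :
  (forall x, 0 <= f x) -> measurable_fun setT f ->
  measurable_fun setT (fun x => (f x)^-1).
Proof.
move=> f0 mf; under eq_fun do rewrite -powR_inv1//.
exact: (@measurableT_comp _ _ _ _ _ _ (@powR R ^~ (-1))).
Qed.

(** * Product integrals over the orthant and positivity of integrals *)

Section Rn_integrals.
Context {R : realType}.
Local Notation leb := (@lebesgue_measure R).
Local Notation mu := leb_Rn.

Lemma measurable_orthant n : measurable (@orthant R n).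
Proof.
rewrite (_ : @orthant R n = \bigcap_(i in [set: 'I_n])
    ((fun x : Rn R n => tnth x i) @^-1` `]0, +oo[%classic)).
  apply: fin_bigcap_measurable => // i _.
  by rewrite -[X in measurable X]setTI; apply: measurable_tnth.
by apply/seteqP; split=> [x xo i _|x xo i]; have := xo i; rewrite /= in_itv/= andbT// => ->.
Qed.

Lemma measurable_prod_tnth n (f : 'I_n -> R -> R) :
  (forall i, measurable_fun setT (f i)) ->
  measurable_fun setT (fun v : Rn R n => \prod_(i < n) f i (tnth v i)).
Proof.
move=> mf; apply: measurable_prod => i _.
by apply: (measurableT_comp (mf i)); exact: measurable_tnth.
Qed.

(** The indicator of the orthant is the product of the indicators of the half-lines. *)
Lemma integral_orthant_prod n (f : 'I_n -> R -> R) (c : 'I_n -> R) :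
  (forall i, measurable_fun setT (f i)) -> (forall i t, 0 <= f i t) ->
  (forall i, \int[leb]_(t in `]0%R, +oo[) (f i t)%:E = (c i)%:E)%E ->
  (\int[mu n]_(v in @orthant R n) (\prod_(i < n) f i (tnth v i))%:E =
   (\prod_(i < n) c i)%:E)%E.
Proof.
move=> mf f0 fc; pose g i (t : R) := f i t * \1_(`]0, +oo[%classic : set R) t.
have gE i t : (g i t)%:E = ((EFin \o f i) \_ (`]0, +oo[%classic : set R)) t.
  by rewrite /g patchE indicE; case: ifP => _; rewrite ?mulr1 ?mulr0.
rewrite -(@integral_leb_Rn_prod _ _ g).
- rewrite integral_mkcond; apply: eq_integral => v _; rewrite patchE.
  case: ifPn => [/[!inE] vo|].
    congr EFin; apply: eq_bigr => i _; rewrite /g indicE mem_set ?mulr1//=.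
    by rewrite in_itv/= andbT; exact: vo.
  rewrite notin_setE => /existsNP[i vi]; congr EFin.
  rewrite (bigD1 i)//= /g indicE memNset ?mulr0 ?mul0r//=.
  by rewrite in_itv/= andbT.
- by move=> i; apply: measurable_funM.
- by move=> i t; rewrite mulr_ge0.
- by move=> i; rewrite -fc [RHS]integral_mkcond; apply: eq_integral => t _; rewrite gE.
Qed.

Lemma integral_gauss_scaled (c : R) : 0 < c ->
  exists C : R, (\int[leb]_x (expR (- (c * x ^+ 2)))%:E = C%:E)%E.
Proof.
move=> c0; exists ((Num.sqrt c)^-1 * Num.sqrt pi).
have sc0 : 0 < Num.sqrt c by rewrite sqrtr_gt0.
rewrite EFinM -integralT_gauss.
rewrite -(@integral_affine _ (Num.sqrt c) 0 (EFin \o gauss_fun))//.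
- apply: eq_integral => x _; rewrite /= /gauss_fun addr0 exprMn sqr_sqrtr//.
  exact: ltW.
- by apply/measurable_EFinP; exact: measurable_gauss_fun.
- by move=> x; rewrite lee_fin gauss_fun_ge0.
Qed.

(** The indicator of the unit cube integrates to 1 and is at most 1. *)
Lemma leb_Rn_setT_gt0 n : (0 < mu n [set: Rn R n])%E.
Proof.
have h : (\int[mu n]_t (\prod_(i < n) \1_(`[0, 1]%classic : set R) (tnth t i))%:E
    = (\prod_(i < n) 1)%:E)%E.
  have l1 : leb (`[0, 1]%classic : set R) = 1%E.
    by rewrite lebesgue_measure_itv/= lte_fin ltr01 oppr0 adde0.
  apply: (@integral_leb_Rn_prod _ _ (fun _ => \1_(`[0, 1]%classic : set R))) => // i.
  by rewrite integral_indic// setIT -[RHS]l1.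
rewrite lt0e measure_ge0 andbT; apply/eqP => mu0.
have : (\int[mu n]_t (\prod_(i < n) \1_(`[0, 1]%classic : set R) (tnth t i))%:E <=
    \int[mu n]_t (cst 1%E t))%E.
  apply: ge0_le_integral => //.
  - by move=> t _; rewrite lee_fin prodr_ge0.
  - apply/measurable_EFinP; apply: (measurable_prod_tnth
      (f := fun _ => \1_(`[0, 1]%classic : set R))) => i.
    exact: measurable_indic.
  - move=> t _; rewrite /= lee_fin prodr_ile1// => i _.
    by rewrite indicE ler0n lern1 leq_b1.
rewrite h big1// integral_cst// [X in (_ * X)%E](_ : _ = 0%E); last exact: mu0.
by rewrite mule0 lee_fin ler10.
Qed.

(** If the integral vanished, f would be zero almost everywhere and the whole space would be
    null. *)
Lemma integral_leb_Rn_gt0 n (f : Rn R n -> R) : measurable_fun setT f ->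
  (forall t, 0 < f t) -> (0 < \int[mu n]_t (f t)%:E)%E.
Proof.
move=> mf f0; rewrite lt0e; apply/andP; split; last first.
  by apply: integral_ge0 => t _; rewrite lee_fin ltW.
apply/eqP => h.
have : (\int[mu n]_t `|(f t)%:E| = 0)%E.
  by rewrite -[RHS]h; apply: eq_integral => t _; rewrite gee0_abs// lee_fin ltW.
move/(ae_eq_integral_abs (mu n) measurableT (iffRL (measurable_EFinP _ _) mf)).
move=> [N [mN N0 sub]].
have : (mu n setT <= mu n N)%E.
  apply: le_measure; rewrite ?inE//.
  move=> t _; apply: sub => /= /(_ Logic.I) [] /eqP; rewrite gt_eqF//; exact: f0.
by rewrite N0 => le0; have := leb_Rn_setT_gt0 n; rewrite ltNge le0.
Qed.

End Rn_integrals.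

Lemma integral_weight1E (R : realType) (q b d : R) : 0 <= b -> 0 < b \/ -1 < q ->
  0 < d -> exists I : R,
  (\int[lebesgue_measure]_(t in `]0%R, +oo[) (weight1 q b d t)%:E = I%:E)%E.
Proof.
move=> b0 bq d0; exists (fine (\int[lebesgue_measure]_(t in `]0%R, +oo[) (weight1 q b d t)%:E)%E).
rewrite fineK// ge0_fin_numE; first exact: integral_weight1_lty.
by apply: integral_ge0 => t _; rewrite lee_fin weight1_ge0.
Qed.

(** * Finiteness of the trace for a product-form joint density *)

Section product_model.
Context {R : realType} (n : nat).
Local Notation leb := (@lebesgue_measure R).
Local Notation mu := (@leb_Rn R n).
Local Notation D := (@orthant R n).
Variables (q a b nu sg : R).
Hypotheses (a0 : 0 < a) (b0 : 0 <= b) (sg0 : 0 < sg).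
Hypothesis bq : 0 < b \/ -1 < q.
(** The common form of the two parameterizations: [lik] is the weight of the data, the [m i] are the
    affine coordinates of the latent field, and u -> l u + [shift l] is the contraction towards
    their common zero. In this section [nu] is the drift parameter of the model and [mu] is Lebesgue
    measure. *)
Variables (c K Cl C1 C2 : R) (lik : Rn R n -> R) (m : 'I_n -> Rn R n -> R).
Variable shift : R -> Rn R n.
Hypotheses (n0 : (0 < n)%N) (c0 : 0 < c) (K0 : 0 <= K) (C10 : 0 < C1).
Hypothesis mlik : measurable_fun setT lik.
Hypothesis mm : forall i, measurable_fun setT (m i).
Hypothesis lik0 : forall u, 0 < lik u.
Hypothesis lik_bounded : forall u, lik u <= Cl.
Hypothesis m_coercive : forall u : Rn R n,
  \sum_(j < n) (tnth u j : R) ^+ 2 <= C1 * \sum_(i < n) m i u ^+ 2 + C2.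
Hypothesis m_contraction : forall l i u, m i (affine_Rn l (shift l) u) = l * m i u.
Hypothesis lik_contraction : forall l u, 0 < l -> l <= 1 ->
  lik u <= K * lik (affine_Rn l (shift l) u).

Local Notation g := (joint1 q a b nu sg).

Definition product_joint (z : Rn R n * Rn R n) : R :=
  c * lik z.1 * \prod_(i < n) g (m i z.1) (tnth z.2 i).
Local Notation j := product_joint.

Lemma measurable_joint1_comp d (T : measurableType d) (f h : T -> R) :
  measurable_fun setT f -> measurable_fun setT h ->
  measurable_fun setT (fun z => g (f z) (h z)).
Proof.
move=> mf mh; have mp r : measurable_fun setT (fun z => h z `^ r).
  by apply: (@measurableT_comp _ _ _ _ _ _ (@powR R ^~ r)).
apply: measurable_funM => //.
apply: measurableT_comp => //; apply: measurableT_comp => //.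
apply: measurable_funM => //; apply: measurable_funD; last exact: measurable_funM.
apply: measurable_funM => //.
apply: measurable_funD => //; apply: measurable_funM => //.
by apply: measurable_funX; apply: measurable_funB => //; exact: measurable_funM.
Qed.

Lemma measurable_product_joint : measurable_fun setT j.
Proof.
apply: measurable_funM.
  apply: measurable_funM => //.
  by apply: (measurableT_comp mlik); exact: measurable_fst.
apply: measurable_prod => i _; apply: measurable_joint1_comp.
  by apply: (measurableT_comp (mm i)); exact: measurable_fst.
apply: (@measurableT_comp _ _ _ _ _ _ (fun v : Rn R n => tnth v i)).
  exact: measurable_tnth.
exact: measurable_snd.
Qed.

Lemma product_joint_ge0 z : 0 <= j z.
Proof.
rewrite mulr_ge0//; first by rewrite mulr_ge0 ?ltW.
by apply: prodr_ge0 => i _; exact: joint1_ge0.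
Qed.

Lemma product_joint_gt0 u v : D v -> 0 < j (u, v).
Proof.
move=> Dv; rewrite mulr_gt0//; first by rewrite mulr_gt0.
by apply: prodr_gt0 => i _; apply: joint1_gt0; exact: Dv.
Qed.

Lemma product_marginalUE u :
  marginalU mu D j u = c * lik u * \prod_(i < n) marginal1 q a b nu sg (m i u).
Proof.
have mD := @measurable_orthant R n.
rewrite /marginalU /Rintegral /product_joint /=.
under eq_integral do rewrite EFinM.
rewrite ge0_integralZl//; last 3 first.
- apply: measurable_funTS; apply/measurable_EFinP.
  by apply: (measurable_prod_tnth (f := fun i => g (m i u))) => i; exact: measurable_joint1.
- by move=> v _; rewrite lee_fin prodr_ge0// => i _; exact: joint1_ge0.
- by rewrite lee_fin mulr_ge0 ?ltW.
rewrite (@integral_orthant_prod _ _ (fun i => g (m i u))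
  (fun i => marginal1 q a b nu sg (m i u)))//.
- by move=> i; exact: measurable_joint1.
- by move=> i t; exact: joint1_ge0.
- by move=> i; exact: marginal1E.
Qed.

Lemma product_marginalU_gt0 u : 0 < marginalU mu D j u.
Proof.
rewrite product_marginalUE mulr_gt0//; first by rewrite mulr_gt0.
by apply: prodr_gt0 => i _; exact: marginal1_gt0.
Qed.

(** For fixed v each factor is at most a Gaussian in m_i(u), with a rate made uniform in i by
    bounding every v_i by their sum S. Coercivity turns this into a Gaussian in u. *)
Lemma product_joint_gauss_bound v : D v -> exists e B, 0 < e /\
  forall u, j (u, v) <= B * \prod_(i < n) expR (- (e * (tnth u i : R) ^+ 2)).
Proof.
move=> Dv; pose S := \sum_(i < n) (tnth v i : R).
have vS i : (tnth v i : R) <= S.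
  by rewrite /S (bigD1 i)//= lerDl; apply: sumr_ge0 => k _; exact: ltW (Dv k).
have S0 : 0 < S by apply: lt_le_trans (vS (Ordinal n0)); exact: Dv.
pose e0 := (4 * sg ^+ 2 * S)^-1.
have e00 : 0 < e0 by rewrite invr_gt0 !mulr_gt0// exprn_gt0.
pose B0 := \sum_(i < n) (nu ^+ 2 * (tnth v i : R) / (2 * sg ^+ 2)).
pose Q := \prod_(i < n) (tnth v i : R) `^ q.
have Q0 : 0 <= Q by apply: prodr_ge0 => i _; exact: powR_ge0.
have gb u : \prod_(i < n) g (m i u) (tnth v i) <=
    Q * expR (B0 - e0 * \sum_(i < n) m i u ^+ 2).
  rewrite mulr_sumr -sumrB expR_sum -big_split/=.
  apply: ler_prod => i _; rewrite joint1_ge0/=.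
  rewrite ler_wpM2l ?powR_ge0// ler_expR.
  set t := (tnth v i : R); have t0 : 0 < t by exact: Dv.
  rewrite powR_inv1 ?(ltW t0)//.
  set x := m i u.
  have h1 : e0 * x ^+ 2 <= x ^+ 2 / (4 * sg ^+ 2 * t).
    rewrite mulrC ler_wpM2l ?sqr_ge0// lef_pV2 ?posrE ?mulr_gt0 ?exprn_gt0//.
    by apply: ler_wpM2l; [rewrite mulr_ge0// sqr_ge0|exact: vS].
  have h2 : 0 <= b / t by rewrite divr_ge0// ltW.
  have h3 : 0 <= a * t by rewrite mulr_ge0// ltW.
  have h4 : 0 <= (x - 2 * nu * t) ^+ 2 / (4 * sg ^+ 2 * t).
    by rewrite divr_ge0 ?sqr_ge0// !mulr_ge0 ?sqr_ge0// ltW.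
  (* Half of the x^2 term is set aside; the other half completes the square with x - 2 nu t. *)
  have -> : 2^-1 * (((x - nu * t) ^+ 2 / sg ^+ 2 + b) / t + a * t) =
     (x ^+ 2 / (4 * sg ^+ 2 * t) - nu ^+ 2 * t / (2 * sg ^+ 2)
      + (x - 2 * nu * t) ^+ 2 / (4 * sg ^+ 2 * t)) + 2^-1 * (b / t) + 2^-1 * (a * t).
    by field; rewrite !gt_eqF.
  lra.
exists (e0 / C1), (c * Cl * (Q * expR (B0 + e0 * C2 / C1))).
split; first by rewrite divr_gt0.
move=> u; rewrite -mulrA ler_pM//.
- by rewrite mulr_ge0 ?ltW.
- by apply: prodr_ge0 => i _; exact: joint1_ge0.
- by rewrite ler_wpM2l ?(ltW c0).
apply: le_trans (gb u) _; rewrite -mulrA ler_wpM2l//.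
rewrite -expR_sum -expRD ler_expR sumrN -mulr_sumr.
have := m_coercive u; rewrite -(ler_pM2l (_ : 0 < e0 / C1)) ?divr_gt0// => h.
have -> : e0 * \sum_(i < n) m i u ^+ 2 =
    e0 / C1 * (C1 * \sum_(i < n) m i u ^+ 2 + C2) - e0 * C2 / C1.
  by field; rewrite gt_eqF.
lra.
Qed.

Lemma integral_product_joint_lty v : D v ->
  (\int[mu]_u (j (u, v))%:E < +oo)%E.
Proof.
move=> Dv; have [e [B [e0 HB]]] := product_joint_gauss_bound Dv.
have [C HC] := integral_gauss_scaled e0.
have mE : measurable_fun setT (fun x : R => expR (- (e * x ^+ 2))).
  by apply: measurableT_comp => //; apply: measurableT_comp => //; exact: measurable_funM.
have B0 : 0 <= B.
  have u0 : Rn R n by exact: [tuple 0 | i < n].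
  have := le_trans (product_joint_ge0 (u0, v)) (HB u0).
  by rewrite pmulr_lge0//; apply: prodr_gt0 => i _; exact: expR_gt0.
apply: (@le_lt_trans _ _ (B%:E * (\prod_(i < n) C)%:E)%E); last by rewrite -EFinM ltry.
rewrite -(@integral_leb_Rn_prod _ _ (fun i x => expR (- (e * x ^+ 2))) (fun _ => C))//.
rewrite -ge0_integralZl//.
- apply: ge0_le_integral => //.
  + by move=> u _; rewrite lee_fin product_joint_ge0.
  + apply/measurable_EFinP; exact: measurable_fun_pair1 measurable_product_joint.
  + apply: measurable_funeM; apply/measurable_EFinP.
    exact: (measurable_prod_tnth (f := fun _ x => expR (- (e * x ^+ 2)))).
  + by move=> u _; rewrite -EFinM lee_fin.
- apply/measurable_EFinP.
  exact: (measurable_prod_tnth (f := fun _ x => expR (- (e * x ^+ 2)))).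
- by move=> u _; rewrite lee_fin prodr_ge0// => i _; exact: expR_ge0.
Qed.

Lemma product_marginalVE v : D v ->
  (\int[mu]_u (j (u, v))%:E = (marginalV mu j v)%:E)%E.
Proof.
move=> Dv; rewrite /marginalV /Rintegral fineK// ge0_fin_numE.
  exact: integral_product_joint_lty.
by apply: integral_ge0 => u _; rewrite lee_fin product_joint_ge0.
Qed.

Lemma product_marginalV_gt0 v : D v -> 0 < marginalV mu j v.
Proof.
move=> Dv; rewrite -lte_fin -product_marginalVE//.
apply: integral_leb_Rn_gt0; first exact: measurable_fun_pair1 measurable_product_joint.
by move=> u; exact: product_joint_gt0.
Qed.

Theorem product_trace_lty :
  (\int[mu]_(v in D) \int[mu]_u
    (j (u, v) ^+ 2 / (marginalU mu D j u * marginalV mu j v))%:E < +oo)%E.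
Proof.
have [l [d [C [l0 l1 d0 C0 H]]]] := @joint1_sqr_le R q a b nu sg a0 b0 sg0 bq.
pose G := marginalU mu D j; pose J := marginalV mu j.
pose w (v : Rn R n) := \prod_(i < n) weight1 q b d (tnth v i).
have w0 v : 0 <= w v by apply: prodr_ge0 => i _; exact: weight1_ge0.
pose T u := affine_Rn l (shift l) u.
(* The factor G(u) cancels against the product of the [marginal1] produced by [joint1_sqr_le], and
   [lik_contraction] moves one copy of the likelihood weight to T u. *)
have key u v : D v -> j (u, v) ^+ 2 / G u <= K * C ^+ n * w v * j (T u, v).
  move=> Dv; rewrite ler_pdivrMr ?product_marginalU_gt0//.
  rewrite /G product_marginalUE /product_joint /=.
  set X1 := \prod_i marginal1 q a b nu sg (m i u).
  set X2 := \prod_(i < n) g (m i (T u)) (tnth v i).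
  have X10 : 0 <= X1 by apply: prodr_ge0 => i _; apply: ltW; exact: marginal1_gt0.
  have X20 : 0 <= X2 by apply: prodr_ge0 => i _; exact: joint1_ge0.
  have HH : \prod_(i < n) (g (m i u) (tnth v i) ^+ 2) <= C ^+ n * X1 * X2 * w v.
    rewrite -[C ^+ n](_ : \prod_(i < n) C = _); last by rewrite prodr_const card_ord.
    rewrite -!big_split /=; apply: ler_prod => i _.
    by rewrite sqr_ge0/= m_contraction; apply: H; exact: Dv.
  rewrite exprMn -prodrXl.
  apply: (le_trans (ler_wpM2l (sqr_ge0 _) HH)).
  have := lik_contraction u l0 l1; rewrite -/(T u) => hl.
  have hh : 0 <= c ^+ 2 * lik u * C ^+ n * X1 * X2 * w v.
    by rewrite !mulr_ge0 ?exprn_ge0 ?(ltW c0) ?(ltW (lik0 _)).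
  have := ler_wpM2l hh hl.
  congr (is_true (_ <= _)); ring.
have mj := measurable_product_joint.
have G_ge0 u : 0 <= G u by apply: ltW; exact: product_marginalU_gt0.
have J_ge0 v : 0 <= J v by apply: Rintegral_ge0 => u _; exact: product_joint_ge0.
have mjG : measurable_fun setT (fun z => (j z ^+ 2 / (G z.1 * J z.2))%:E).
  apply/measurable_EFinP; apply: measurable_funM; first exact: measurable_funX.
  apply: measurable_inv_ge0.
    by move=> z; exact: mulr_ge0.
  apply: measurable_funM.
    apply: measurableT_comp; last exact: measurable_fst.
    apply: measurable_marginalU => //; first exact: measurable_orthant.
    exact: product_joint_ge0.
  apply: measurableT_comp; last exact: measurable_snd.
  by apply: measurable_marginalV => //; exact: product_joint_ge0.
have jG0 z : (0 <= (j z ^+ 2 / (G z.1 * J z.2))%:E)%E.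
  by rewrite lee_fin; apply: divr_ge0; [exact: sqr_ge0|exact: mulr_ge0].
(* The change of variables by T gives l^-n J(v), which cancels the J(v) of the denominator and
   leaves only w(v) to integrate. *)
have inner v : D v -> (\int[mu]_u (j (u, v) ^+ 2 / (G u * J v))%:E <=
    (K * C ^+ n * l ^- n * w v)%:E)%E.
  move=> Dv; have Jv := product_marginalV_gt0 Dv.
  have mT : measurable_fun setT (fun u => (j (u, v))%:E).
    by apply/measurable_EFinP; exact: measurable_fun_pair1 mj.
  have mTT : measurable_fun setT (fun u => (j (T u, v))%:E).
    by apply: (measurableT_comp mT); exact: measurable_affine_Rn.
  have KC0 : 0 <= K * C ^+ n * w v / J v.
    by rewrite divr_ge0 ?(ltW Jv)// !mulr_ge0// exprn_ge0.
  apply: (@le_trans _ _ (\int[mu]_u ((K * C ^+ n * w v / J v)%:E * (j (T u, v))%:E))%E).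
    apply: ge0_le_integral => //.
    - exact: (measurable_fun_pair1 v mjG).
    - exact: measurable_funeM.
    - move=> u _; rewrite -EFinM lee_fin invfM mulrA [leRHS]mulrAC.
      by apply: ler_wpM2r; [rewrite invr_ge0 ltW|exact: key].
  rewrite ge0_integralZl//; last by move=> u _; rewrite lee_fin product_joint_ge0.
  rewrite (@integral_affine_Rn _ _ l (shift l) (fun u => (j (u, v))%:E))//; last first.
    by move=> u; rewrite lee_fin product_joint_ge0.
  rewrite product_marginalVE// -/J -!EFinM lee_fin le_eqVlt; apply/orP; left.
  by apply/eqP; rewrite -/(J v); field; rewrite ?expf_neq0 ?gt_eqF.
have [I HI] := integral_weight1E b0 bq d0.
have KCl : 0 <= K * C ^+ n * l ^- n.
  by rewrite !mulr_ge0 ?exprn_ge0// invr_ge0 exprn_ge0// ltW.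
have mw : measurable_fun D (fun v => (w v)%:E).
  apply: measurable_funTS; apply/measurable_EFinP.
  apply: (measurable_prod_tnth (f := fun _ => weight1 q b d)) => i.
  exact: measurable_weight1.
apply: (@le_lt_trans _ _ ((K * C ^+ n * l ^- n)%:E * (\prod_(i < n) I)%:E)%E); last first.
  by rewrite -EFinM ltry.
rewrite -(@integral_orthant_prod _ _ (fun _ => weight1 q b d) (fun _ => I))//; last 2 first.
- by move=> i; exact: measurable_weight1.
- by move=> i t; exact: weight1_ge0.
have mD := @measurable_orthant R n.
rewrite -ge0_integralZl//.
apply: ge0_le_integral => //.
- by move=> v _; apply: integral_ge0 => u _; exact: (jG0 (u, v)).
- apply: measurable_funTS.
  exact: (measurable_fun_fubini_tonelli_G (fun z => (j z ^+ 2 / (G z.1 * J z.2))%:E)).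
- exact: measurable_funeM.
- by move=> v _; rewrite lee_fin; exact: w0.
Qed.

End product_model.

(** * The linear latent model *)

Section affine_maps.
Context {R : realType}.
Implicit Types (k n : nat).

Lemma measurable_affine_form k n (B : 'M[R]_(k, n)) (e : 'cV[R]_k) i :
  measurable_fun setT (fun u : Rn R n => (B *m vec u + e) i ord0).
Proof.
rewrite (_ : (fun u => _) = (fun u : Rn R n => \sum_(j < n) B i j * (tnth u j : R) + e i ord0)).
  apply: measurable_funD => //; apply: measurable_sum => j.
  by apply: measurable_funM => //; exact: measurable_tnth.
by apply/funext => u; rewrite !mxE; congr (_ + _); apply: eq_bigr => j _; rewrite mxE.
Qed.

Lemma vec_affine_Rn n (l : R) (s u : Rn R n) :
  vec (affine_Rn l s u) = l *: vec u + vec s.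
Proof. by apply/colP => i; rewrite !mxE tnth_mktuple. Qed.

Definition tuple_of_vec n (x : 'cV[R]_n) : Rn R n := [tuple x i ord0 | i < n].

Lemma tuple_of_vecK n (x : 'cV[R]_n) : vec (tuple_of_vec x) = x.
Proof. by apply/colP => i; rewrite !mxE tnth_mktuple. Qed.

(** The map is the homothety of ratio l centred at u0, and affine maps preserve convex
    combinations. *)
Lemma affine_contraction k n (B : 'M[R]_(k, n)) (e : 'cV[R]_k) (u0 : 'cV[R]_n)
    (l : R) (u : Rn R n) :
  B *m vec (affine_Rn l (tuple_of_vec ((1 - l) *: u0)) u) + e =
  l *: (B *m vec u + e) + (1 - l) *: (B *m u0 + e).
Proof.
rewrite vec_affine_Rn tuple_of_vecK mulmxDr -!scalemxAr !scalerDr.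
rewrite addrACA -scalerDl [l + _]addrC subrK scale1r.
by [].
Qed.

(** Lagrange's identity: the difference is half the double sum of the squares (a_i x_j - a_j
    x_i)^2. *)
Lemma sum_mul_sqr_le n (a x : 'I_n -> R) :
  (\sum_i a i * x i) ^+ 2 <= (\sum_i a i ^+ 2) * (\sum_i x i ^+ 2).
Proof.
rewrite expr2 !big_distrlr /= -subr_ge0.
suff -> : \sum_i \sum_j a i ^+ 2 * x j ^+ 2 - \sum_i \sum_j a i * x i * (a j * x j) =
    2^-1 * \sum_i \sum_j (a i * x j - a j * x i) ^+ 2.
  by rewrite mulr_ge0 ?invr_ge0// sumr_ge0// => i _; rewrite sumr_ge0// => j _; exact: sqr_ge0.
have sw : \sum_i \sum_j a i ^+ 2 * x j ^+ 2 = \sum_i \sum_j a j ^+ 2 * x i ^+ 2.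
  by rewrite exchange_big.
transitivity (2^-1 * (\sum_i \sum_j a i ^+ 2 * x j ^+ 2 +
    \sum_i \sum_j a j ^+ 2 * x i ^+ 2 - 2 * \sum_i \sum_j a i * x i * (a j * x j))).
  by rewrite -sw; field.
congr (_ * _); rewrite mulr_sumr -big_split/= -sumrB; apply: eq_bigr => i _.
rewrite mulr_sumr -big_split/= -sumrB; apply: eq_bigr => j _; ring.
Qed.

(** Cauchy-Schwarz on u = N^-1 x with x = (N u + e) - e; F is the squared Frobenius norm of the
    inverse. *)
Lemma affine_coercive n (N : 'M[R]_n) (e : 'cV[R]_n) : N \in unitmx ->
  exists C1 C2, 0 < C1 /\ forall u : Rn R n,
  \sum_(j < n) (tnth u j : R) ^+ 2 <=
    C1 * \sum_(i < n) (N *m vec u + e) i ord0 ^+ 2 + C2.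
Proof.
move=> uN; pose F := \sum_(j < n) \sum_(i < n) invmx N j i ^+ 2.
have F0 : 0 <= F by apply: sumr_ge0 => j _; apply: sumr_ge0 => i _; exact: sqr_ge0.
pose E := \sum_(i < n) e i ord0 ^+ 2.
exists (2 * F + 1), (2 * F * E); split; first by rewrite ltr_wpDl// mulr_ge0.
move=> u; set S := \sum_i (N *m vec u + e) i ord0 ^+ 2.
have S0 : 0 <= S by apply: sumr_ge0 => i _; exact: sqr_ge0.
pose x i := (N *m vec u + e) i ord0 - e i ord0.
have X : \sum_i x i ^+ 2 <= 2 * S + 2 * E.
  rewrite !mulr_sumr -big_split/=; apply: ler_sum => i _; rewrite /x.
  move: ((N *m vec u + e) i ord0) (e i ord0) => s r.
  by have := sqr_ge0 (s + r); lra.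
have uE j : (tnth u j : R) = \sum_i invmx N j i * x i.
  have : vec u = invmx N *m (N *m vec u) by rewrite mulKmx.
  move/matrixP => /(_ j ord0); rewrite mxE => ->; rewrite mxE; apply: eq_bigr => i _.
  by congr (_ * _); rewrite /x [in RHS]mxE addrK.
apply: (@le_trans _ _ (F * \sum_i x i ^+ 2)).
  by rewrite mulr_suml; apply: ler_sum => j _; rewrite uE sum_mul_sqr_le.
by have := ler_wpM2l F0 X; lra.
Qed.

Definition gauss_weight k (s : R) (x : 'cV[R]_k) : R :=
  expR (- (s * \sum_i x i ord0 ^+ 2)).

(** By convexity the squared norm at the contracted point is at most the sum of those at u and at
    u0; the latter gives the constant factor. *)
Lemma gauss_weight_contraction k n (B : 'M[R]_(k, n)) (e : 'cV[R]_k)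
    (u0 : 'cV[R]_n) (s l : R) (u : Rn R n) : 0 <= s -> 0 < l -> l <= 1 ->
  gauss_weight s (B *m vec u + e) <=
  expR (s * \sum_i (B *m u0 + e) i ord0 ^+ 2) *
    gauss_weight s (B *m vec (affine_Rn l (tuple_of_vec ((1 - l) *: u0)) u) + e).
Proof.
move=> s0 l0 l1; rewrite /gauss_weight affine_contraction -expRD ler_expR.
move: (B *m vec u + e) (B *m u0 + e) => r r0.
suff h : \sum_i (l *: r + (1 - l) *: r0) i ord0 ^+ 2 <=
    \sum_i r i ord0 ^+ 2 + \sum_i r0 i ord0 ^+ 2.
  by have := ler_wpM2l s0 h; lra.
rewrite -big_split/=; apply: ler_sum => i _; rewrite !mxE.
move: (r i ord0) (r0 i ord0) => y z.
have -> : y ^+ 2 + z ^+ 2 = (l * y + (1 - l) * z) ^+ 2 + l * (1 - l) * (y - z) ^+ 2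
  + (1 - l) * y ^+ 2 + l * z ^+ 2 by ring.
have l1' : 0 <= 1 - l by rewrite subr_ge0.
rewrite -addrA -addrA lerDl.
have l0' := ltW l0; by rewrite !addr_ge0// mulr_ge0 ?sqr_ge0// mulr_ge0.
Qed.

End affine_maps.

Lemma mvn_pdf_diag (R : realType) n (mean x : 'cV[R]_n) (d : 'I_n -> R) :
  (forall i, 0 < d i) ->
  mvn_pdf mean (diag_mx (\row_i d i)) x =
  (Num.sqrt ((2 * pi) ^+ n * \prod_i d i))^-1 *
  expR (- (2^-1 * \sum_i (x - mean) i ord0 ^+ 2 / d i)).
Proof.
move=> d0; rewrite /mvn_pdf det_diag.
have -> : \prod_i (\row_i d i) ord0 i = \prod_i d i by apply: eq_bigr => i _; rewrite mxE.
have DD : diag_mx (\row_i d i) *m diag_mx (\row_i (d i)^-1) = 1%:M.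
  rewrite mulmx_diag; apply/matrixP => i k; rewrite !mxE.
  by rewrite divff// gt_eqF.
have -> : invmx (diag_mx (\row_i d i)) = diag_mx (\row_i (d i)^-1).
  have [u1 _] := mulmx1_unit DD.
  by rewrite -[RHS]mul1mx -(mulVmx u1) -mulmxA DD mulmx1.
congr (_ * expR (- (_ * _))); rewrite mxE; apply: eq_bigr => i _.
rewrite mul_mx_diag !mxE; ring.
Qed.

(** * Both parameterizations in product form *)

Section model.
Context (R : realType) (m n q : nat) (par : parameterization).
Context (M : llngm R m n q) (y : 'cV[R]_m).
Hypotheses (hK : ll_K M \in unitmx).
Hypotheses (hsigma : 0 < ll_sigma M) (hsigma_eps : 0 < ll_sigma_eps M).
Local Notation sg := (ll_sigma M).
Local Notation D := (@orthant R n).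

(* Under both parameterizations the vector whose law given V is
   N(mu V, diag(sigma^2 V)) and the residual of the data are affine in the
   latent field: they are [latent_mx u + latent_cst] and [resid_mx u + resid_cst]. *)
Definition latent_mx : 'M[R]_n :=
  if par is Centered then ll_K M else 1%:M.
Definition latent_cst : 'cV[R]_n :=
  if par is Centered then ll_mu M *: ll_h M else 0.
Definition resid_mx : 'M[R]_(m, n) :=
  if par is Centered then - ll_A M else - (ll_A M *m invmx (ll_K M)).
Definition resid_cst : 'cV[R]_m := y - ll_X M *m ll_beta M +
  if par is Centered then 0 else ll_A M *m invmx (ll_K M) *m (ll_mu M *: ll_h M).

Lemma latent_mx_unit : latent_mx \in unitmx.
Proof. by rewrite /latent_mx; case: par => //; exact: unitmx1. Qed.

Definition latent_coord (i : 'I_n) (u : Rn R n) : R :=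
  (latent_mx *m vec u + latent_cst) i ord0.

Definition lik (u : Rn R n) : R :=
  gauss_weight (2^-1 * (ll_sigma_eps M ^+ 2)^-1) (resid_mx *m vec u + resid_cst).

Lemma likelihoodE : exists2 c, 0 < c &
  forall u, likelihood par M y u = c * lik u.
Proof.
pose s2 := ll_sigma_eps M ^+ 2; have s20 : 0 < s2 by rewrite exprn_gt0.
exists (Num.sqrt ((2 * pi) ^+ m * \prod_(i < m) s2))^-1.
  rewrite invr_gt0 sqrtr_gt0 mulr_gt0//; last by apply: prodr_gt0.
  by rewrite exprn_gt0// mulr_gt0// pi_gt0.
move=> u; rewrite /likelihood -diag_const_mx.
rewrite (_ : const_mx _ = \row_i (fun=> s2) i); last by apply/rowP => i; rewrite !mxE.
rewrite mvn_pdf_diag//; congr (_ * expR (- _)); rewrite -mulr_suml mulrA mulrAC.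
congr (_ * _); apply: eq_bigr => i _; congr (_ ^+ 2).
congr ((_ : 'cV__) i ord0); rewrite /resid_mx /resid_cst; case: par.
  by rewrite addr0 mulNmx opprD addrA addrC.
rewrite mulmxA mulmxBr mulNmx opprD opprB.
  by rewrite [in RHS]addrC -!addrA.
Qed.

Lemma sqrtr_prod (d : 'I_n -> R) : (forall i, 0 < d i) ->
  Num.sqrt (\prod_i d i) = \prod_i (d i) `^ 2^-1.
Proof.
move=> d0; transitivity ((\prod_i d i) `^ 2^-1).
  by rewrite powR12_sqrt// prodr_ge0// => i _; exact: ltW.
suff [] : \prod_i d i `^ 2^-1 = (\prod_i d i) `^ 2^-1 /\ 0 <= \prod_i d i by [].
  elim/big_rec2: _ => [|i x z _ [-> z0]]; first by rewrite powR1.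
  by rewrite powRM ?mulr_ge0// ltW.
Qed.

(** A diagonal normal density depends on its argument only through the deviation from the mean,
    which in both cases is [latent_coord] minus mu v. The factor |det K| of the centered case goes
    into the constant. *)
Lemma latent_pdfE : exists2 c, 0 < c & forall v u, D v ->
  latent_pdf par M v u = c * \prod_(i < n) ((tnth v i : R) `^ (- 2^-1) *
    expR (- (2^-1 * ((latent_coord i u - ll_mu M * tnth v i) ^+ 2 / sg ^+ 2 *
       (tnth v i : R) `^ (-1))))).
Proof.
pose c0 := (Num.sqrt ((2 * pi) ^+ n * (sg ^+ 2) ^+ n))^-1 : R.
have c00 : 0 < c0.
  rewrite invr_gt0 sqrtr_gt0 mulr_gt0 ?exprn_gt0//.
  by rewrite mulr_gt0// pi_gt0.
have key (v : Rn R n) (x mean : 'cV[R]_n) (u : Rn R n) : D v ->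
    (forall i, (x - mean) i ord0 = latent_coord i u - ll_mu M * tnth v i) ->
    mvn_pdf mean (scale_mx M v) x = c0 * \prod_(i < n) ((tnth v i : R) `^ (- 2^-1) *
    expR (- (2^-1 * ((latent_coord i u - ll_mu M * tnth v i) ^+ 2 / sg ^+ 2 *
       (tnth v i : R) `^ (-1))))).
  move=> Dv H; rewrite /scale_mx mvn_pdf_diag; last first.
    by move=> i; rewrite mulr_gt0 ?exprn_gt0//; exact: Dv.
  rewrite [in RHS]big_split/= mulrA; congr (_ * _).
    rewrite big_split/= prodr_const card_ord mulrA sqrtrM; last first.
      by rewrite mulr_ge0// exprn_ge0// ?mulr_ge0 ?pi_ge0// ?exprn_ge0// ltW.
    rewrite sqrtr_prod// invfM; congr (_ * _); rewrite -prodfV; apply: eq_bigr => i _.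
    by rewrite powRN.
  rewrite mulr_sumr -sumrN expR_sum; apply: eq_bigr => i _; congr (expR (- (_ * _))).
  by rewrite H powR_inv1 ?(ltW (Dv _))// invfM mulrA.
rewrite /latent_pdf; have : forall i u v, latent_coord i u - ll_mu M * tnth v i =
    (latent_mx *m vec u + latent_cst) i ord0 - ll_mu M * tnth v i by [].
rewrite /latent_mx /latent_cst; case: par => H.
  exists (`|\det (ll_K M)| * c0).
    by rewrite mulr_gt0// normr_gt0 -unitfE -unitmxE.
  move=> v u Dv; rewrite -mulrA (key v _ _ u Dv)// => i.
  by rewrite H !mxE; ring.
exists c0 => // v u Dv; rewrite (key v _ _ u Dv)// => i.
by rewrite H mul1mx !mxE; ring.
Qed.

(** The constant is stated to be nonnegative only; positivity of the overall constant is deduced in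
    [theorem2p1] from the posterior having mass 1. *)
Lemma mixing_pdfE : exists2 c, 0 <= c & forall v, D v ->
  mixing_pdf M v = c * \prod_(i < n) ((tnth v i : R) `^ (ll_p M - 1) *
    expR (- (2^-1 * (ll_b M * (tnth v i : R) `^ (-1) + ll_a M * tnth v i)))).
Proof.
pose Z := \int[@lebesgue_measure R]_(t in `]0, +oo[) gig_kernel (ll_p M) (ll_a M) (ll_b M) t.
exists (Z ^- n).
  rewrite invr_ge0 exprn_ge0// Rintegral_ge0// => t _.
  by rewrite mulr_ge0 ?powR_ge0 ?expR_ge0.
move=> v Dv; rewrite /mixing_pdf /gig_pdf -/Z big_split/= mulrC prodr_const card_ord exprVn.
congr (_ * _); apply: eq_bigr => i _; rewrite /gig_kernel; congr (_ * expR (- (_ * _))).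
by rewrite powR_inv1 ?(ltW (Dv _))// addrC.
Qed.

Lemma joint_pdfE : exists2 c, 0 <= c & forall u v, D v ->
  joint_pdf par M y u v =
  product_joint (ll_p M - 2^-1 - 1) (ll_a M) (ll_b M) (ll_mu M) sg c lik latent_coord (u, v).
Proof.
have [c1 c10 H1] := likelihoodE; have [c2 c20 H2] := latent_pdfE.
have [c3 c30 H3] := mixing_pdfE.
exists (c1 * c2 * c3); first by rewrite !mulr_ge0// ltW.
move=> u v Dv; rewrite /joint_pdf H1 H2// H3// /product_joint /=.
transitivity (c1 * c2 * c3 * lik u * (\prod_(i < n) ((tnth v i : R) `^ (- 2^-1) *
    expR (- (2^-1 * ((latent_coord i u - ll_mu M * tnth v i) ^+ 2 / sg ^+ 2 *
       (tnth v i : R) `^ (-1))))) * \prod_(i < n) ((tnth v i : R) `^ (ll_p M - 1) *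
    expR (- (2^-1 * (ll_b M * (tnth v i : R) `^ (-1) + ll_a M * tnth v i)))))); first by ring.
rewrite -big_split/=; congr (_ * _); apply: eq_bigr => i _; rewrite /joint1 mulrACA.
rewrite -powRD; last by apply/implyP => _; rewrite gt_eqF//; exact: Dv.
rewrite -expRD; congr (_ `^ _ * expR _); ring.
Qed.

(* The common zero of the coordinates: contracting towards it scales them all. *)
Definition latent_center : 'cV[R]_n := - (invmx latent_mx *m latent_cst).

Definition latent_shift (l : R) : Rn R n := tuple_of_vec ((1 - l) *: latent_center).

Lemma latent_coord_contraction l i u :
  latent_coord i (affine_Rn l (latent_shift l) u) = l * latent_coord i u.
Proof.
rewrite /latent_coord affine_contraction mulmxN mulmxA mulmxV ?latent_mx_unit//.
by rewrite mul1mx addNr scaler0 addr0 mxE.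
Qed.

Lemma latent_coord_coercive : exists C1 C2, 0 < C1 /\ forall u : Rn R n,
  \sum_(j < n) (tnth u j : R) ^+ 2 <= C1 * \sum_(i < n) latent_coord i u ^+ 2 + C2.
Proof. exact/affine_coercive/latent_mx_unit. Qed.

Lemma measurable_latent_coord i : measurable_fun setT (latent_coord i).
Proof. exact: measurable_affine_form. Qed.

Lemma lik_contraction : exists2 C, 0 <= C & forall l u, 0 < l -> l <= 1 ->
  lik u <= C * lik (affine_Rn l (latent_shift l) u).
Proof.
eexists; last by move=> l u l0 l1; apply: gauss_weight_contraction => //;
  rewrite mulr_ge0 ?invr_ge0 ?sqr_ge0.
exact: expR_ge0.
Qed.

Lemma lik_le1 u : lik u <= 1.
Proof.
rewrite /lik /gauss_weight -expR0 ler_expR oppr_le0.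
by rewrite !mulr_ge0 ?invr_ge0 ?sqr_ge0 ?sumr_ge0// => i _; exact: sqr_ge0.
Qed.

Lemma measurable_lik : measurable_fun setT lik.
Proof.
apply: (measurableT_comp (@measurable_expR R)); apply: measurableT_comp => //.
apply: measurable_funM => //; apply: measurable_sum => i.
by apply: measurable_funX; exact: measurable_affine_form.
Qed.

End model.

Theorem theorem2p1 (R : realType) (m n q : nat) (par : parameterization)
    (M : llngm R m n q) (y : 'cV[R]_m) (P : probability (Rn R n) R)
    (hm : (1 <= m)%N) (hn : (1 <= n)%N)
    (hK : ll_K M \in unitmx)
    (hsigma : 0 < ll_sigma M) (hsigma_eps : 0 < ll_sigma_eps M)
    (hgig : gig_params (ll_p M) (ll_a M) (ll_b M))
    (hP : is_posterior par M y P)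
    (hcond : (0 < ll_a M /\ 0 < ll_b M) \/ [/\ 0 < ll_a M, ll_b M = 0 & 2^-1 < ll_p M]) :
  exists L : LspaceType2 P -> LspaceType2 P,
    is_gibbs_operator par M y L /\ trace_class L.
Proof.
have a0 : 0 < ll_a M by case: hcond => -[].
have b0 : 0 <= ll_b M by case: hcond => [[_ /ltW]|[_ -> _]].
(* The exponent of each v_i is p - 3/2, which exceeds -1 exactly when p > 1/2. *)
have bp : 0 < ll_b M \/ -1 < ll_p M - 2^-1 - 1.
  by case: hcond => [[_ b0']|[_ _ p0]]; [left|right; lra].
have [c c0 jE] := joint_pdfE par y hK hsigma hsigma_eps.
pose D := @orthant R n; have mD : measurable D := @measurable_orthant R n.
pose mu := @leb_Rn R n.
set j := product_joint _ _ _ _ _ c _ _ in jE.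
pose J := marginalV mu j.
pose Z := \int[mu]_(v in D) J v.
have JE v : D v -> \int[lebesgue_Rn n]_u joint_pdf par M y u v = J v.
  by move=> Dv; apply: eq_Rintegral => u _; exact: jE.
have ZE : \int[lebesgue_Rn n]_(w in D) \int[lebesgue_Rn n]_u joint_pdf par M y u w = Z.
  by apply: eq_Rintegral => w /[!inE] Dw; exact: JE.
have PE E : measurable E -> P E = (\int[mu]_(v in E `&` D) (J v / Z)%:E)%E.
  move=> mE.
  transitivity (\int[mu]_(v in E `&` D) (pdf_V par M y v)%:E)%E; first exact: hP.
  apply: eq_integral => v /[!inE] -[_ Dv].
  by rewrite /pdf_V ZE (JE v Dv).
(* Division by zero yields 0, so Z = 0 would give the probability P total mass 0. *)
have Zn0 : Z != 0.
  apply/eqP => Z0; have := @probability_setT _ _ _ P.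
  rewrite (PE _ measurableT); under eq_integral do rewrite Z0 invr0 mulr0.
  by rewrite integral0 => /eqP; rewrite eqe eq_sym oner_eq0.
have cp : 0 < c.
  rewrite lt_neqAle c0 andbT eq_sym; apply: contra_neq Zn0 => c_eq0.
  have j_eq0 z : j z = 0 by rewrite /j /product_joint c_eq0 !mul0r.
  have int0 A : \int[mu]_(_ in A) (0 : R) = 0 by rewrite /Rintegral integral0.
  rewrite -[RHS](int0 D); apply: eq_Rintegral => v _; rewrite -[RHS](int0 setT).
  by apply: eq_Rintegral => u _; exact: j_eq0.
have lik0 u : 0 < lik par M y u by exact: expR_gt0.
have j0 z : 0 <= j z by apply: product_joint_ge0.
have Zp : 0 < Z.
  rewrite lt_neqAle eq_sym Zn0 /=; apply: Rintegral_ge0 => v _.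
  by apply: Rintegral_ge0 => u _; exact: j0.
have [K K0 hlik] := @lik_contraction R m n q par M y.
have [C1 [C2 [C10 hcoord]]] := latent_coord_coercive par hK.
have mlik := @measurable_lik R m n q par M y.
have mcoord := @measurable_latent_coord R m n q par M.
have mj : measurable_fun setT j by exact: measurable_product_joint.
have lik1 := @lik_le1 R m n q par M y.
have hshift := @latent_coord_contraction R m n q par M hK.
have tr := product_trace_lty (ll_mu M) a0 b0 hsigma bp hn cp K0 C10 mlik mcoord lik0 lik1
  hcoord hshift hlik.
have G0 u : 0 < marginalU mu D j u.
  exact: (product_marginalU_gt0 (ll_mu M) a0 b0 hsigma bp _ cp lik0).
have J0 v : D v -> 0 < J v.
  exact: (product_marginalV_gt0 _ (ll_mu M) a0 b0 hsigma hn cp C10 mlik mcoord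
    lik0 lik1 hcoord).
have [L [Lk Ltr]] := gibbs_sampler_trace_class mD mj j0 G0 J0 Zp PE tr.
exists L; split; last exact: Ltr.
move=> f.
apply: filterS2 (Lk f) (ae_posterior_support mD PE) => v [iv Lv] Dv.
have kE v' : D v' -> gibbs_kernel par M y v v' =
    (\int[mu]_u (j (u, v') / marginalU mu D j u * (j (u, v) / J v))%:E)%E.
  (* [lebesgue_Rn n] and [leb_Rn n] are the same function, so integrals against them are
     convertible. *)
  move=> Dv'; transitivity
    (\int[mu]_u (pdf_V_given_U par M y u v' * pdf_U_given_V par M y v u)%:E)%E.
    by [].
  apply: eq_integral => u _; rewrite /pdf_V_given_U /pdf_U_given_V.
  rewrite (jE u v Dv) (jE u v' Dv') (JE v Dv); congr (_ / _ * _)%:E.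
  by apply: eq_Rintegral => w /[!inE] Dw; exact: jE.
suff [h1 h2] :
    mu.-integrable D (fun v' => gibbs_kernel par M y v v' * (f v' : R)%:E)%E /\
    (L f v : R)%:E = (\int[mu]_(v' in D) (gibbs_kernel par M y v v' * (f v' : R)%:E))%E.
  split; [exact: h1|exact: h2].
split.
  by apply: eq_integrable iv => [//|v' /[!inE] Dv']; rewrite (kE v' Dv').
by rewrite Lv; apply: eq_integral => v' /[!inE] Dv'; rewrite (kE v' Dv').
Qed.
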